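(* There exist universal constants $C,D>0$ (one can take $D=4$ and some $C\le 570$) which can be used simultaneously in the following two statements. (i) For every random variable $X$ with values in $\mathbb{N}$ and distribution $\mu$, all $\lambda,\tau>0$ and all $r\ge1$: if $\mathbb{E}[e^{i\xi X}]e^{-\lambda(e^{i\xi}-1)}=1+\sum_{s\ge2}b_s(e^{i\xi}-1)^s$ for all $\xi \in \mathbb{R}$, with $|b_s|\le(\tau/\sqrt{s})^s$ for all $s\geq 2$, and if $D\tau/\sqrt{\lambda}<1$, then $d_{\mathrm{TV}}(\mu,\nu^{(r)})\le C(D\tau/\sqrt\lambda)^{r+1}$, where $\nu^{(r)}$ is the signed measure on $\mathbb{N}$ with Fourier transform $e^{\lambda(e^{i\xi}-1)}(1+\sum_{s=2}^r b_s(e^{i\xi}-1)^s)$. (ii) Let $(X_n)_{n\in\mathbb{N}}$ be a sequence of random variables with values in $\mathbb{N}$, with distributions $(\mu_n)_{n\in\mathbb{N}}$. Suppose that $(X_n)_{n\in\mathbb{N}}$ converges mod-Poisson with parameters $(\lambda_n)_{n\in\mathbb{N}}$ ($\lambda_n>0$) and Bernoulli asymptotics, in the sense that for some square-summable countable family $A$ of real numbers, some $\rho>1$ and some sequence $(\varepsilon_n)_{n\in\mathbb{N}}$ going to zero, $$\forall w\in D(0,\rho),\quad \left|\mathbb{E}[w^{X_n}]\,e^{-\lambda_n(w-1)}-\mathfrak{E}(A',w-1)\right|\le\varepsilon_n .$$ Set $\sigma^2=\sum_{a\in A}a^2$. Let $r\ge1$ and let $\nu_{n,*}^{(r)}$ be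 the derived approximation scheme of order $r$ of $X_n$. If $\sqrt{\lambda_n}>D\sqrt{e}\,\sigma$, then $$d_{\mathrm{TV}}(\mu_n,\nu_{n,*}^{(r)})\le C\left(\frac{D\sqrt{e}\,\sigma}{\sqrt{\lambda_n}}\right)^{r+1}+\varepsilon_n\left(\frac{\rho}{\rho-1}+\lambda_n\right).$$ In particular, if the sequence $(\lambda_n)_{n\in\mathbb{N}}$ goes to infinity and if $\varepsilon_n=O\big((\lambda_n)^{-\frac{r+3}{2}}\big)$, then $d_{\mathrm{TV}}(\mu_n,\nu_{n,*}^{(r)})=O\big((\lambda_n)^{-\frac{r+1}{2}}\big)$.
   Context: $\mathbb{N}=\{0,1,2,\ldots\}$, $e=\exp(1)$, and $D(0,\rho)$ is the disc of center $0$ and radius $\rho$ in $\mathbb{C}$. For signed measures $\mu,\nu$ on $\mathbb{N}$, $d_{\mathrm{TV}}(\mu,\nu)=\frac12\sum_{k\in\mathbb{N}}|\mu(k)-\nu(k)|$. The Fourier transform of a signed measure $\nu$ on $\mathbb{N}$ is $\widehat\nu(\xi)=\sum_{k\in\mathbb{N}}\nu(k)e^{ik\xi}$. For a countable family $A=\{a_1,a_2,\ldots\}$ of real numbers (with repetitions allowed) with $\sum_i a_i^2<+\infty$, $\mathfrak{E}(A',\cdot)$ denotes the entire function $$\mathfrak{E}(A',z)=\prod_{i\ge1}(1+a_iz)\,e^{-a_iz}=1+\sum_{s=2}^\infty \mathfrak{e}_s(A')\,z^s ,$$ which defines the real coefficients $\mathfrak{e}_s(A')$. The derived approximation scheme of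 order $r$ of $X_n$ is the signed measure $\nu_{n,*}^{(r)}$ on $\mathbb{N}$ with Fourier transform $$\widehat{\nu}_{n,*}^{(r)}(\xi)=e^{\lambda_n(e^{i\xi}-1)}\Big(1+\sum_{s=2}^r \mathfrak{e}_s(A')\,(e^{i\xi}-1)^s\Big).$$ *)

(* Defs.v *)
From HB Require Import structures.
From mathcomp Require Import all_boot all_order all_algebra.
From mathcomp Require Import all_classical all_reals all_analysis.
From mathcomp Require Import complex.

Set Implicit Arguments.
Unset Strict Implicit.
Unset Printing Implicit Defensive.

Import Order.TTheory GRing.Theory Num.Theory.
Import numFieldNormedType.Exports.

Local Open Scope classical_set_scope.
Local Open Scope ring_scope.
Local Open Scope complex_scope.

(* Limits in R[i] are taken in its regular normed module (R[i])^o.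
   The norm `|z| of R[i] is itself complex-valued; this is the real one. *)
Definition cmod (R : realType) (z : R[i]) : R := complex.Re `|z|.

Definition cexp (R : realType) (z : R[i]) : R[i] :=
  (expR (complex.Re z))%:C * (cos (complex.Im z) +i* sin (complex.Im z)).

(* t |-> e^{it} *)
Definition expi (R : realType) (t : R) : R[i] := cexp (0 +i* t).

Definition cintegrable (R : realType) (d : measure_display)
    (T : measurableType d) (P : probability T R) (Z : T -> R[i]) : Prop :=
  P.-integrable setT (fun t => (complex.Re (Z t))%:E) /\
  P.-integrable setT (fun t => (complex.Im (Z t))%:E).

Definition cexpectation (R : realType) (d : measure_display)
    (T : measurableType d) (P : probability T R) (Z : T -> R[i]) : R[i] :=
  fine 'E_P[fun t => complex.Re (Z t)] +i* fine 'E_P[fun t => complex.Im (Z t)].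

Definition dTV (R : realType) (mu nu : set nat -> \bar R) : \bar R :=
  ((2^-1)%:E * \sum_(k <oo) `|mu [set k] - nu [set k]|)%E.

Definition fourier (R : realType) (nu : {charge set nat -> \bar R}) (xi : R)
    : R[i] :=
  limn (fun N => (\sum_(k < N) (fine (nu [set nat_of_ord k]))%:C
                   * expi (k%:R * xi)) : (R[i])^o).

(* "The" signed measure on nat whose Fourier transform is phi: its values are
   determined by phi since the Fourier transform is injective on finite signed
   measures. The zero charge is a dummy value for the functions phi that are
   not Fourier transforms. *)
Definition signed_measure_of_fourier (R : realType) (phi : R -> R[i])
    : {charge set nat -> \bar R} :=
  match pselect (exists nu : {charge set nat -> \bar R},
                   forall xi : R, fourier nu xi = phi xi) with
  | left h => sval (cid h)
  | right _ => czero
  end.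

(* The signed measure with Fourier transform
   e^{lambda (e^{i xi} - 1)} (1 + \sum_{s=2}^r b_s (e^{i xi} - 1)^s). *)
Definition poisson_scheme (R : realType) (lambda : R) (b : nat -> R[i])
    (r : nat) : {charge set nat -> \bar R} :=
  signed_measure_of_fourier (fun xi : R =>
    cexp (lambda%:C * (expi xi - 1))
    * (1 + \sum_(2 <= s < r.+1) b s * (expi xi - 1) ^+ s)).

(* A countable family of reals is enumerated by a sequence a : nat -> R; a
   finite family is padded with zeros, which contribute the factor 1 to the
   product frakE and nothing to the sum of squares. *)
Definition square_summable (R : realType) (a : nat -> R) : Prop :=
  cvgn (series (fun i => a i ^+ 2)).

Definition l2norm (R : realType) (a : nat -> R) : R :=
  Num.sqrt (limn (series (fun i => a i ^+ 2))).

Definition frakE (R : realType) (a : nat -> R) (z : R[i]) : R[i] :=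
  limn (fun N => (\prod_(i < N) ((1 + (a i)%:C * z) * cexp (- (a i)%:C * z)))
                 : (R[i])^o).

(* The real coefficients of the power series expansion of frakE a on the whole
   plane; these conditions have exactly one solution when a is square
   summable (the zero sequence is a dummy value). *)
Definition frake (R : realType) (a : nat -> R) : nat -> R :=
  xget (fun _ => 0) [set e : nat -> R | [/\ e 0%N = 1, e 1%N = 0 &
    forall z : R[i],
      (fun N => (\sum_(s < N) (e s)%:C * z ^+ s) : (R[i])^o) @ \oo
        --> (frakE a z : (R[i])^o)]].

Definition derived_scheme (R : realType) (lambda : R) (a : nat -> R) (r : nat)
    : {charge set nat -> \bar R} :=
  poisson_scheme lambda (fun s => (frake a s)%:C) r.

(* Each X n may live on its own probability space. The integrability clause
   says that E[w^(X n)] is well defined on the (open) disc of radius rho. *)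
Definition mod_poisson_bernoulli (R : realType) (d : nat -> measure_display)
    (T : forall n, measurableType (d n)) (P : forall n, probability (T n) R)
    (X : forall n, {RV (P n) >-> nat}) (lambda a : nat -> R) (rho : R)
    (eps : nat -> R) : Prop :=
  [/\ square_summable a, 1 < rho, eps @ \oo --> (0 : R) &
    forall (n : nat) (w : R[i]), cmod w < rho ->
      cintegrable (P n) (fun t => w ^+ X n t) /\
      cmod (cexpectation (P n) (fun t => w ^+ X n t)
              * cexp (- (lambda n)%:C * (w - 1))
            - frakE a (w - 1)) <= eps n].

(* Main.v *)
Require Import Defs.
From HB Require Import structures.
From mathcomp Require Import all_boot all_order all_algebra.
From mathcomp Require Import all_classical all_reals all_analysis.
From mathcomp Require Import complex ring lra.
Set Implicit Arguments.
Unset Strict Implicit.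
Unset Printing Implicit Defensive.
Import Order.TTheory GRing.Theory Num.Theory.
Import numFieldNormedType.Exports.
Local Open Scope classical_set_scope.
Local Open Scope ring_scope.
Local Open Scope complex_scope.

(** The theorem holds with C = 1 and D = 4. Write w = e^(i xi) and z = w - 1. The
    objects compared are real sequences, and they are handled through their
    generating functions in w ([gf]), with two tools: the l1 norm is
    submultiplicative for the convolution ([conv_bound]), and each coefficient is
    bounded by the supremum of the generating function on a circle
    ([gf_cauchy]), which in particular makes generating functions injective
    ([gf_inj]).

    The main estimate is the l1 norm of z^s e^(lambda z). For s = 1 it is
    E|N - lambda| / lambda for a Poisson variable N of mean lambda, hence at most
    1 / sqrt lambda ([bdiff_pois_bound]). In general z^s e^(lambda z) is the s-th
    power of z e^((lambda / s) z), so its norm is at most (s / lambda)^(s/2)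
    ([iter_bdiff_pois_bound]). If |b_s| <= (tau / sqrt s)^s, the powers of s cancel,
    and the scheme of order r differs from all schemes of higher order by at most
    the tail of a geometric series of ratio tau / sqrt lambda ([scheme_tail]).

    In part (i), the schemes of order S converge to the law coefficient by
    coefficient when S tends to infinity, because their transforms converge
    uniformly on the circle ([scheme_approx]); since the bound above is uniform in S,
    it passes to the limit. For the scheme to exist as a signed measure the b_s
    have to be real, which follows from the symmetry of characteristic functions
    ([circle_coefs_real]).

    In part (ii), |1 + u| <= exp (Re u + |u|^2 / 2) shows that the canonical product
    is at most exp (sigma^2 |z|^2 / 2) in modulus, so Cauchy's estimate gives
    |e_s| <= (sqrt e sigma / sqrt s)^s ([frake_le]). The product has a power series
    expansion because the coefficients of the partial products converge
    ([lim_coef_cvg]). The law then differs from a scheme of large order by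
    e^(lambda z) times a function of size about eps_n on a disc of radius greater
    than 1, whose coefficients decay geometrically by Cauchy's estimate
    ([dTV_derived_scheme_le]). *)

(** * Complex modulus and convergence *)

Section ComplexModulus.
Variable R : realType.
Implicit Types (x y : R) (z w : R[i]) (u v : nat -> R[i]).

(** The norm of R[i] is complex-valued; this lemma and the injectivity and
    monotony of the embedding of R transport its theory to [cmod]. *)
Lemma normC_cmod z : `|z| = (cmod z)%:C.
Proof. by rewrite /cmod normc_def. Qed.

Lemma cmod_ge0 z : 0 <= cmod z.
Proof. by rewrite -ler0c -normC_cmod. Qed.

Lemma cmodM z w : cmod (z * w) = cmod z * cmod w.
Proof. by apply: complexI; rewrite rmorphM -!normC_cmod normrM. Qed.

Lemma cmod0 : cmod (0 : R[i]) = 0.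
Proof. by apply: complexI; rewrite -normC_cmod normr0. Qed.

Lemma cmod1 : cmod (1 : R[i]) = 1.
Proof. by apply: complexI; rewrite -normC_cmod normr1. Qed.

Lemma cmodX z n : cmod (z ^+ n) = cmod z ^+ n.
Proof. by apply: complexI; rewrite rmorphXn -!normC_cmod normrX. Qed.

Lemma cmodN z : cmod (- z) = cmod z.
Proof. by apply: complexI; rewrite -!normC_cmod normrN. Qed.

Lemma cmod_real x : cmod x%:C = `|x|.
Proof. by rewrite /cmod normc_def /= expr0n addr0 sqrtr_sqr. Qed.

Lemma cmod_nat n : cmod (n%:R : R[i]) = n%:R.
Proof. by rewrite -(rmorph_nat (real_complex R)) cmod_real normr_nat. Qed.

Lemma cmodD z w : cmod (z + w) <= cmod z + cmod w.
Proof. by rewrite -lecR rmorphD -!normC_cmod ler_normD. Qed.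

Lemma cmodB z w : cmod (z - w) <= cmod z + cmod w.
Proof. by rewrite -(cmodN w) cmodD. Qed.

Lemma cmod_eq0 z : cmod z = 0 -> z = 0.
Proof. by move=> h; apply/normr0_eq0; rewrite normC_cmod h. Qed.

Lemma cmod_sum (I : Type) (r : seq I) (P : pred I) (F : I -> R[i]) :
  cmod (\sum_(i <- r | P i) F i) <= \sum_(i <- r | P i) cmod (F i).
Proof.
elim/big_rec2: _ => [|i x z _ h]; first by rewrite cmod0.
by rewrite (le_trans (cmodD _ _)) // lerD2l.
Qed.

Lemma conjM z w : conjc (z * w) = conjc z * conjc w.
Proof. exact: (rmorphM (@conjc R)). Qed.

Lemma conjX z n : conjc (z ^+ n) = conjc z ^+ n.
Proof. exact: (rmorphXn (@conjc R)). Qed.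

Lemma conjB z w : conjc (z - w) = conjc z - conjc w.
Proof. exact: (rmorphB (@conjc R)). Qed.

Lemma conjN z : conjc (- z) = - conjc z.
Proof. exact: (rmorphN (@conjc R)). Qed.

Lemma conj_sum N (F : 'I_N -> R[i]) : conjc (\sum_k F k) = \sum_k conjc (F k).
Proof. exact: (rmorph_sum (@conjc R)). Qed.

Lemma cmodJ z : cmod (conjc z) = cmod z.
Proof. by apply: complexI; rewrite -!normC_cmod normcJ. Qed.

Lemma Re_le_cmod z : `|complex.Re z| <= cmod z.
Proof. by rewrite -lecR -normC_cmod normc_ge_Re. Qed.

Lemma cmodE z : cmod z = Num.sqrt (complex.Re z ^+ 2 + complex.Im z ^+ 2).
Proof. by rewrite /cmod normc_def. Qed.

Lemma Im_le_cmod z : `|complex.Im z| <= cmod z.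
Proof. by rewrite cmodE -sqrtr_sqr ler_sqrt ?lerDr ?addr_ge0 ?sqr_ge0. Qed.

Lemma cmod_le_ReIm z : cmod z <= `|complex.Re z| + `|complex.Im z|.
Proof.
rewrite {1}(complexE z) (le_trans (cmodD _ _))// cmodM !cmod_real.
suff -> : cmod ('i : R[i]) = 1 by rewrite mul1r.
by rewrite cmodE /= expr0n add0r expr1n sqrtr1.
Qed.

Lemma ReD z w : complex.Re (z + w) = complex.Re z + complex.Re w.
Proof. by case: z w => [? ?] [? ?]. Qed.

Lemma ImD z w : complex.Im (z + w) = complex.Im z + complex.Im w.
Proof. by case: z w => [? ?] [? ?]. Qed.

Lemma ReB z w : complex.Re (z - w) = complex.Re z - complex.Re w.
Proof. by case: z w => [? ?] [? ?]. Qed.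

Lemma ImB z w : complex.Im (z - w) = complex.Im z - complex.Im w.
Proof. by case: z w => [? ?] [? ?]. Qed.

Definition ccvg u (l : R[i]) : Prop :=
  (u : nat -> (R[i])^o) @ \oo --> (l : (R[i])^o).

(** The radii of the balls of R[i] are elements of R[i]; only the real positive
    ones matter. *)
Lemma ccvgP u (l : R[i]) : ccvg u l <->
  forall e : R, 0 < e -> \forall n \near \oo, cmod (u n - l) < e.
Proof.
have dC (a b : R[i]) : `|(a : (R[i])^o) - b| = (cmod (b - a))%:C.
  by rewrite -normC_cmod -[RHS]normrN opprB.
split=> [/cvgrPdist_lt h e e0|h].
  have /h : (0 : R[i]) < e%:C by rewrite ltcR.
  by apply: filterS => n; rewrite dC ltcR.
apply/cvgrPdist_lt => e; rewrite ltcE /= => /andP[/eqP i0 e0].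
have -> : e = (complex.Re e)%:C by rewrite {1}(complexE e) i0 mulr0 addr0.
by apply: filterS (h _ e0) => n; rewrite dC ltcR.
Qed.

Lemma ccvg_ReIm u (l : R[i]) :
  (fun n => complex.Re (u n)) @ \oo --> complex.Re l ->
  (fun n => complex.Im (u n)) @ \oo --> complex.Im l ->
  ccvg u l.
Proof.
move=> /cvgrPdist_lt hr /cvgrPdist_lt hi; apply/ccvgP => e e0.
have e2 : 0 < e / 2 by rewrite divr_gt0.
near=> n; apply: (le_lt_trans (cmod_le_ReIm _)).
rewrite [e]splitr ltrD //.
  have : `|complex.Re l - complex.Re (u n)| < e / 2.
    by near: n; exact: hr.
  by rewrite distrC -ReB.
have : `|complex.Im l - complex.Im (u n)| < e / 2.
  by near: n; exact: hi.
by rewrite distrC -ImB.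
Unshelve. all: by end_near. Qed.

Lemma ccvg_cmodB u (l : R[i]) :
  ccvg u l ->
  (fun n => cmod (u n - l)) @ \oo --> (0 : R).
Proof.
move=> /ccvgP h; apply/cvgrPdist_lt => e e0; apply: filterS (h e e0) => n.
by rewrite sub0r normrN ger0_norm ?cmod_ge0.
Qed.

Lemma ccvg_squeeze u (l : R[i]) (x : nat -> R) : x @ \oo --> (0 : R) ->
  (forall n, cmod (u n - l) <= x n) ->
  ccvg u l.
Proof.
move=> /cvgrPdist_lt h ux; apply/ccvgP => e e0; apply: filterS (h e e0) => n.
rewrite sub0r normrN => xe; apply: le_lt_trans (ux n) _.
exact: le_lt_trans (ler_norm _) xe.
Qed.

Lemma ccvg_unique u (l l' : R[i]) :
  ccvg u l ->
  ccvg u l' -> l = l'.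
Proof.
move=> h h'; exact: (cvg_unique (@norm_hausdorff _ ((R[i])^o)) h h').
Qed.

Lemma ccvg_lim u (l : R[i]) : ccvg u l -> limn (u : nat -> (R[i])^o) = l.
Proof. exact: (cvg_lim (@norm_hausdorff _ ((R[i])^o))). Qed.

Lemma ccvg_cmod u (l : R[i]) :
  ccvg u l ->
  (fun n => cmod (u n)) @ \oo --> cmod l.
Proof.
move=> /ccvg_cmodB/cvgrPdist_lt h; apply/cvgrPdist_lt => e e0.
apply: filterS (h e e0) => n; rewrite sub0r normrN ger0_norm ?cmod_ge0 //=.
apply: le_lt_trans; rewrite ler_norml; apply/andP; split.
  by have := cmodD (u n - l) l; rewrite subrK; lra.
have := cmodB (u n) (u n - l).
by rewrite opprB addrCA subrr addr0; lra.
Qed.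

Lemma ccvg_cmod_le u (l : R[i]) (B : R) :
  ccvg u l ->
  (forall n, cmod (u n) <= B) -> cmod l <= B.
Proof.
move=> /ccvg_cmod h uB; rewrite -(cvg_lim (@Rhausdorff R) h); apply: limr_le.
  exact: cvgP h.
by apply: nearW.
Qed.

Lemma ccvgD u v (k l : R[i]) :
  ccvg u k ->
  ccvg v l ->
  ccvg (fun n => u n + v n) (k + l).
Proof.
move=> /ccvg_cmodB h /ccvg_cmodB h'.
have hD : (fun n => cmod (u n - k) + cmod (v n - l)) @ \oo --> (0 + 0 : R).
  exact: cvgD.
rewrite addr0 in hD.
apply: (ccvg_squeeze hD) => n; apply: le_trans (cmodD _ _).
by rewrite opprD addrACA.
Qed.

Lemma ccvgM u v (k l : R[i]) :
  ccvg u k ->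
  ccvg v l ->
  ccvg (fun n => u n * v n) (k * l).
Proof.
move=> /ccvg_cmodB h hv; have h' := ccvg_cmodB hv.
have hM : (fun n => cmod (u n - k) * cmod (v n) + cmod k * cmod (v n - l))
    @ \oo --> (0 * cmod l + cmod k * 0 : R).
  apply: cvgD; first by apply: cvgM => //; exact: ccvg_cmod.
  by apply: cvgM => //; exact: cvg_cst.
rewrite mul0r mulr0 addr0 in hM; apply: (ccvg_squeeze hM) => n.
rewrite -!cmodM; apply: le_trans (cmodD _ _).
by rewrite mulrBl mulrBr addrA subrK.
Qed.

Lemma ccvgB u v (k l : R[i]) :
  ccvg u k -> ccvg v l -> ccvg (fun n => u n - v n) (k - l).
Proof.
move=> uk vl; apply: ccvgD uk _.
apply: (ccvg_squeeze (ccvg_cmodB vl)) => n.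
by rewrite -opprD cmodN.
Qed.

Lemma ccvg_shift u (l : R[i]) m :
  ccvg (fun n => u (n + m)%N) l <->
  ccvg u l.
Proof. by rewrite /ccvg (cvg_shiftn m (u : nat -> (R[i])^o)).
Qed.

Lemma ccvg_conj u (l : R[i]) :
  ccvg u l ->
  ccvg (fun n => conjc (u n)) (conjc l).
Proof.
move=> /ccvg_cmodB h; apply: ccvg_squeeze h _ => n.
by rewrite -rmorphB -lecR -!normC_cmod normcJ.
Qed.

Lemma ccvg_cst z : ccvg (fun=> z) z.
Proof. exact: cvg_cst. Qed.

End ComplexModulus.

(** * Series and Cauchy products *)

Section Summation.
Variable R : realType.
Implicit Types (c d g : nat -> R) (u v : nat -> R[i]).

Definition abs_summable c := exists B : R, forall N, \sum_(k < N) `|c k| <= B.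

Lemma abs_summableB (c d : nat -> R) : abs_summable c -> abs_summable d ->
  abs_summable (fun k => c k - d k).
Proof.
move=> [B hB] [D hD]; exists (B + D) => N.
apply: le_trans (lerD (hB N) (hD N)); rewrite -big_split /=.
by apply: ler_sum => j _; exact: ler_normB.
Qed.

(** The start M of the tail may be increased at will, since several tails have
    to be made small at the same time. *)
Lemma abs_summable_tail c (e : R) : abs_summable c -> 0 < e ->
  exists M0, forall M N, (M0 <= M)%N -> \sum_(M <= k < N) `|c k| <= e.
Proof.
move=> [B cB] e0; pose s : nat -> R := fun N => \sum_(k < N) `|c k|.
have s_nd : nondecreasing_seq s.
  by apply/nondecreasing_seqP => n; rewrite /s big_ord_recr lerDl.
have s_ub : has_ubound (range s) by exists B => _ [n _ <-]; exact: cB.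
have cvg_s := nondecreasing_is_cvgn s_nd s_ub.
have s_lim n : s n <= limn s by exact: nondecreasing_cvgn_le.
have /cvgrPdist_lt/(_ _ e0)[M0 _ hM] := cvg_s.
exists M0 => M N M0M; have [NM|MN] := leqP N M; first by rewrite big_geq // ltW.
have -> : \sum_(M <= k < N) `|c k| = s N - s M.
  rewrite /s -!(big_mkord xpredT (fun k => `|c k|)).
  by rewrite (big_cat_nat (leq0n M) (ltnW MN)) /= addrAC subrr add0r.
have := hM M M0M; rewrite /= ltr_distlC => /andP[h _].
by rewrite lerBlDr addrC; apply: le_trans (s_lim N) _; lra.
Qed.

(** Tannery's theorem: beyond some M the tails of both series are controlled by
    the summable bound g, and the first M terms converge one by one. *)
Lemma tannery (f : nat -> nat -> R[i]) g (l : nat -> R[i]) (L : R[i]) :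
  (forall k, ccvg (fun N => f N k) (l k)) ->
  (forall N k, cmod (f N k) <= g k) -> abs_summable g ->
  ccvg (fun N => \sum_(k < N) l k) L ->
  ccvg (fun N => \sum_(k < N) f N k) L.
Proof.
move=> fl fg gs lL.
have lg k : cmod (l k) <= g k by apply: ccvg_cmod_le (fl k) _ => N; exact: fg.
suff h : ccvg (fun N => \sum_(k < N) (f N k - l k)) 0.
  have := ccvgD h lL; rewrite add0r; congr ccvg.
  by apply/funext => N; rewrite -big_split; apply: eq_bigr => k _ /=; rewrite subrK.
apply/ccvgP => e e0.
have e4 : 0 < e / 4 by lra.
have [M hM] := abs_summable_tail gs e4.
have head : (fun N => \sum_(k < M) cmod (f N k - l k)) @ \oo --> (0 : R).
  elim: M {hM} => [|M IH].
    by under eq_fun do rewrite big_ord0; exact: cvg_cst.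
  under eq_fun do rewrite big_ord_recr /=.
  have h : (fun N => \sum_(k < M) cmod (f N k - l k) + cmod (f N M - l M))
      @ \oo --> (0 + 0 : R) by apply: cvgD => //; exact: ccvg_cmodB.
  by rewrite addr0 in h.
have /cvgrPdist_lt/(_ _ e4)[K _ hK] := head.
exists (maxn K M) => // N; rewrite /= geq_max => /andP[KN MN].
rewrite subr0; apply: le_lt_trans (cmod_sum _ _ _) _.
rewrite -(big_mkord xpredT (fun k => cmod (f N k - l k))).
rewrite (big_cat_nat (leq0n M) MN) /= big_mkord.
have h1 : \sum_(k < M) cmod (f N k - l k) < e / 4.
  by have := hK N KN; rewrite /= sub0r normrN; apply: le_lt_trans; exact: ler_norm.
have h2 : \sum_(M <= k < N) cmod (f N k - l k) <= \sum_(M <= k < N) `|g k| *+ 2.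
  apply: ler_sum_nat => k _; rewrite mulr2n; apply: le_trans (cmodB _ _) _.
  by apply: lerD; [apply: le_trans (fg N k) _ | apply: le_trans (lg k) _];
    exact: ler_norm.
rewrite sumrMnl mulr2n in h2; have := hM M N (leqnn M).
lra.
Qed.

Lemma sum_triangle (S : nzRingType) (a b : nat -> S) N :
  \sum_(n < N) \sum_(k < n.+1) a k * b (n - k)%N =
  \sum_(k < N) a k * \sum_(j < N - k) b j.
Proof.
elim: N => [|N IH]; first by rewrite !big_ord0.
rewrite big_ord_recr /= IH [RHS]big_ord_recr /= subSnn big_ord1.
rewrite [X in _ + X]big_ord_recr /= subnn addrA; congr (_ + _).
rewrite -big_split /=; apply: eq_bigr => k _.
by rewrite subSn ?(ltnW (ltn_ord k))// big_ord_recr /= mulrDr.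
Qed.

Definition conv c d n := \sum_(k < n.+1) c k * d (n - k)%N.

Lemma conv_bound c d (C D : R) :
  (forall N, \sum_(k < N) `|c k| <= C) -> (forall N, \sum_(k < N) `|d k| <= D) ->
  forall N, \sum_(n < N) `|conv c d n| <= C * D.
Proof.
move=> hC hD N; have D0 : 0 <= D by have := hD 0%N; rewrite big_ord0.
have h : \sum_(n < N) `|conv c d n| <=
  \sum_(n < N) \sum_(k < n.+1) `|c k| * `|d (n - k)%N|.
  apply: ler_sum => n _; apply: le_trans (ler_norm_sum _ _ _) _.
  by apply: ler_sum => k _; rewrite normrM.
apply: le_trans h _.
rewrite (sum_triangle (fun k => `|c k|) (fun k => `|d k|)).
apply: le_trans (_ : \sum_(k < N) `|c k| * D <= _).
  by apply: ler_sum => k _; apply: ler_wpM2l.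
by rewrite -mulr_suml; apply: ler_wpM2r.
Qed.

(** Cauchy product: by [sum_triangle] its partial sums are
    sum_(k < N) u_k V_(N - k), to which Tannery's theorem applies. *)
Lemma ccvg_conv u v (U V : R[i]) :
  abs_summable (fun k => cmod (u k)) -> abs_summable (fun k => cmod (v k)) ->
  ccvg (fun N => \sum_(k < N) u k) U ->
  ccvg (fun N => \sum_(k < N) v k) V ->
  ccvg (fun N => \sum_(n < N) \sum_(k < n.+1) u k * v (n - k)%N) (U * V).
Proof.
move=> [A uA] [B vB] hU hV.
rewrite (_ : (fun N => _) = (fun N => \sum_(k < N) u k * \sum_(j < N - k) v j)).
  2: by apply/funext => N; rewrite sum_triangle.
apply: (tannery (f := fun N k => u k * \sum_(j < N - k) v j)
  (g := fun k => cmod (u k) * B) (l := fun k => u k * V)).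
- move=> k; apply: ccvgM; first exact: ccvg_cst.
  apply/(ccvg_shift _ _ k); rewrite (_ : (fun n => _) = fun n => \sum_(j < n) v j) //.
  by apply/funext => n; rewrite addnK.
- move=> N k; rewrite cmodM; apply: ler_wpM2l; first exact: cmod_ge0.
  apply: le_trans (cmod_sum _ _ _) _; apply: le_trans (vB (N - k)%N).
  by apply: ler_sum => j _; exact: ler_norm.
- exists (A * B) => N; have B0 : 0 <= B by have := vB 0%N; rewrite big_ord0.
  under eq_bigr do rewrite normrM (ger0_norm B0).
  by rewrite -mulr_suml; apply: ler_wpM2r.
- rewrite (_ : (fun N => _) = fun N => (\sum_(k < N) u k) * V).
    by apply: ccvgM => //; exact: ccvg_cst.
  by apply/funext => N; rewrite mulr_suml.
Qed.

Lemma ccvg_abs_summable u : abs_summable (fun k => cmod (u k)) ->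
  exists l : R[i],
    ccvg (fun N => \sum_(k < N) u k) l.
Proof.
move=> [B hB].
have cvg_real c : (forall k, `|c k| <= cmod (u k)) -> cvgn (series c).
  move=> cu; apply: normed_cvg; apply: nondecreasing_is_cvgn.
    apply/nondecreasing_seqP => n; rewrite /= /series /=.
    by rewrite big_nat_recr //= lerDl.
  exists B => _ [n _ <-]; rewrite /= /series /= big_mkord.
  apply: le_trans (hB n); apply: ler_sum => k _; apply: le_trans (cu k) _.
  exact: ler_norm.
exists (limn (series (fun k => complex.Re (u k))) +i*
        limn (series (fun k => complex.Im (u k)))).
have hRe n : complex.Re (\sum_(k < n) u k) = series (fun k => complex.Re (u k)) n.
  rewrite /series /= big_mkord; elim/big_rec2: _ => [|k x y _ <-] //.
  by case: (u k) y => [? ?] [? ?].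
have hIm n : complex.Im (\sum_(k < n) u k) = series (fun k => complex.Im (u k)) n.
  rewrite /series /= big_mkord; elim/big_rec2: _ => [|k x y _ <-] //.
  by case: (u k) y => [? ?] [? ?].
apply: ccvg_ReIm => /=.
  by rewrite (funext hRe); apply: cvg_real => k; exact: Re_le_cmod.
by rewrite (funext hIm); apply: cvg_real => k; exact: Im_le_cmod.
Qed.

Lemma sum_geometric_le (M x : R) N : 0 <= M -> 0 <= x -> x < 1 ->
  \sum_(k < N) M * x ^+ k <= M / (1 - x).
Proof.
move=> M0 x0 x1; rewrite -mulr_sumr; apply: ler_wpM2l => //.
have x1' : 0 < 1 - x by lra.
rewrite -[_^-1]mul1r ler_pdivlMr// -[leLHS]opprK -mulrN opprB mulrC -subrX1 opprB.
by rewrite gerBl exprn_ge0.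
Qed.

(** The bound x <= 1/2 makes 1 / (1 - x) at most 2; both x = 1/2 and arbitrarily
    small x are needed. *)
Lemma ccvg_geometric_tail u (l : R[i]) (M x : R) : 0 <= M -> 0 <= x -> x <= 2^-1 ->
  (forall k, cmod (u k) <= M * x ^+ k) ->
  ccvg (fun N => \sum_(k < N) u k) l ->
  forall S, cmod (l - \sum_(k < S) u k) <= 2 * M * x ^+ S.
Proof.
move=> M0 x0 x_half uM ul S.
have h : ccvg (fun n => \sum_(k < n + S) u k + - \sum_(k < S) u k)
              (l - \sum_(k < S) u k).
  apply: ccvgD; last exact: ccvg_cst.
  by apply/(ccvg_shift (fun N => \sum_(k < N) u k)).
apply: ccvg_cmod_le h _ => n.
rewrite addnC big_split_ord /= addrAC subrr add0r.
apply: le_trans (cmod_sum _ _ _) _.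
have x1 : x < 1 by lra.
have MS0 : 0 <= M * x ^+ S by rewrite mulr_ge0 ?exprn_ge0.
apply: le_trans (_ : \sum_(k < n) (M * x ^+ S) * x ^+ k <= _).
  by apply: ler_sum => k _; rewrite -mulrA -exprD; exact: uM.
apply: le_trans (sum_geometric_le n MS0 x0 x1) _.
rewrite mulrC -mulrA ler_wpM2r//.
have -> : 2 = (2^-1)^-1 :> R by rewrite invrK.
by rewrite lef_pV2 ?posrE; lra.
Qed.

End Summation.

(** * The complex exponential *)

Section ComplexExponential.
Variable R : realType.
Implicit Types (x y t : R) (z w : R[i]).

Lemma cexpD z w : cexp (z + w) = cexp z * cexp w.
Proof.
case: z w => [a b] [c d]; rewrite /cexp /= expRD cosD sinD rmorphM /=.
by rewrite mulrACA; congr (_ * _); simpc; congr (_ +i* _); ring.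
Qed.

Lemma cexp0 : cexp (0 : R[i]) = 1.
Proof. by rewrite /cexp /= expR0 cos0 sin0 mul1r. Qed.

Lemma cmod_cexp z : cmod (cexp z) = expR (complex.Re z).
Proof.
rewrite /cexp cmodM cmod_real ger0_norm ?expR_ge0// cmodE /= cos2Dsin2.
by rewrite sqrtr1 mulr1.
Qed.

Lemma cexp_nat (n : nat) z : cexp (n%:R * z) = cexp z ^+ n.
Proof.
elim: n => [|n IH]; first by rewrite mul0r cexp0.
by rewrite -natr1 mulrDl mul1r cexpD IH exprSr.
Qed.

Lemma cmod_expi t : cmod (expi t) = 1.
Proof. by rewrite cmod_cexp /= expR0. Qed.

Lemma expiE t : expi t = cos t +i* sin t.
Proof. by rewrite /expi /cexp /= expR0 mul1r. Qed.

Lemma expi_nat (n : nat) t : expi (n%:R * t) = expi t ^+ n.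
Proof.
rewrite /expi -cexp_nat; congr cexp.
by rewrite -(rmorph_nat (real_complex R)); simpc.
Qed.

Lemma expiN t : expi (- t) = conjc (expi t).
Proof. by rewrite !expiE cosN sinN. Qed.

Lemma abs_summable_exp (x : R) : 
  forall N, \sum_(k < N) `|(k`!%:R)^-1 * x ^+ k| <= expR `|x|.
Proof.
move=> N.
rewrite (_ : \sum_(k < N) _ = series (exp_coeff `|x|) N).
  apply: nondecreasing_cvgn_le; last exact: is_cvg_series_exp_coeff.
  apply/nondecreasing_seqP => n; rewrite /series /= big_nat_recr //= lerDl.
  by rewrite exp_coeff_ge0.
rewrite /series /= big_mkord; apply: eq_bigr => k _.
by rewrite normrM normfV normrX (ger0_norm (ler0n _ _)) mulrC.
Qed.

Let expc z k : R[i] := ((k`!%:R : R)^-1)%:C * z ^+ k.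

Lemma abs_summable_cexp z : abs_summable (fun k => cmod (expc z k)).
Proof.
exists (expR (cmod z)) => N; have := abs_summable_exp (cmod z) N.
congr (_ <= _); last by rewrite ger0_norm ?cmod_ge0.
apply: eq_bigr => k _; rewrite cmodM cmod_real cmodX normrM.
by rewrite normrM normr_id !normrX.
Qed.

Lemma imag_pow (b : R) k : (0 +i* b) ^+ k =
  ((~~ odd k)%:R * (-1) ^+ k./2 * b ^+ k)
  +i* ((odd k)%:R * (-1) ^+ k.-1./2 * b ^+ k).
Proof.
have ib : (0 +i* b) = 'i * b%:C by simpc.
rewrite ib exprMn -rmorphXn /=.
have -> : 'i ^+ k = ((~~ odd k)%:R * (-1) ^+ k./2)
     +i* ((odd k)%:R * (-1) ^+ k.-1./2) :> R[i].
  rewrite -{1}(odd_double_half k) exprD -muln2 mulnC exprM sqr_i.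
  have -> : (-1 : R[i]) ^+ k./2 = ((-1) ^+ k./2 : R)%:C.
    by rewrite rmorphXn rmorphN1.
  case ok : (odd k); last first.
    by rewrite expr0 mul1r /real_complex_def /=; congr Complex; ring.
  have -> : k.-1./2 = k./2.
    by rewrite -[k in LHS](odd_double_half k) ok /= (half_bit_double k./2 false).
  by rewrite expr1; simpc => /=; congr Complex; ring.
by simpc.
Qed.

(** The exponential series at x + i y is the Cauchy product of the one at x and
    the one at i y, whose real and imaginary parts are the series of cos y and
    sin y. *)
Lemma ccvg_cexp z :
  ccvg (fun N => \sum_(k < N) ((k`!%:R : R)^-1)%:C * z ^+ k) (cexp z).
Proof.
have hre (a : R) : ccvg (fun N => \sum_(k < N) expc a%:C k) (expR a)%:C.
  have h N : \sum_(k < N) expc a%:C k = (series (exp_coeff a) N)%:C.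
    rewrite /series /= big_mkord rmorph_sum; apply: eq_bigr => k _.
    by rewrite /expc -rmorphXn -rmorphM mulrC.
  rewrite (funext h); apply: ccvg_ReIm => /=; last exact: cvg_cst.
  exact: is_cvg_series_exp_coeff.
have him (b : R) : ccvg (fun N => \sum_(k < N) expc (0 +i* b) k)
    (cos b +i* sin b).
  have h N : \sum_(k < N) expc (0 +i* b) k =
     (series (cos_coeff b) N) +i* (series (sin_coeff b) N).
    rewrite /series /= !big_mkord; elim: N => [|N IH]; first by rewrite !big_ord0.
    rewrite !big_ord_recr /= IH; simpc => /=; rewrite /expc imag_pow.
    rewrite /cos_coeff /sin_coeff /= -exprnP; simpc => /=; congr Complex; ring.
  rewrite (funext h); apply: ccvg_ReIm => /=.
    rewrite unlock; exact: is_cvg_series_cos_coeff.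
  rewrite unlock; exact: is_cvg_series_sin_coeff.
case: z => a b.
have := ccvg_conv (abs_summable_cexp a%:C) (abs_summable_cexp (0 +i* b))
  (hre a) (him b).
rewrite /cexp /=; congr ccvg; apply/funext => N; apply: eq_bigr => n _.
have -> : a +i* b = a%:C + (0 +i* b) by simpc.
rewrite addrC exprDn mulr_sumr; apply: eq_bigr => k _.
have natC (m : nat) (w : R[i]) : w *+ m = (m%:R : R)%:C * w.
  by rewrite rmorph_nat mulr_natl.
rewrite natC /expc mulrACA -rmorphM [RHS]mulrA -rmorphM [X in _ * X]mulrC /=.
congr (_%:C * _).
have kn : (k <= n)%N by rewrite -ltnS.
have := bin_fact kn => /(congr1 (fun m : nat => m%:R : R)); rewrite !natrM => <-.
have f0 m : m`!%:R != 0 :> R by rewrite pnatr_eq0 -lt0n fact_gt0.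
have b0 : 'C(n, k)%:R != 0 :> R by rewrite pnatr_eq0 -lt0n bin_gt0.
by field; rewrite !f0 b0.
Qed.

End ComplexExponential.

(** * Cauchy's estimate on the unit circle *)

Section CauchyEstimate.
Variable R : realType.
Implicit Types (c d : nat -> R).

(** For a number of roots that is a power of 2, primitivity follows from
    e^(i pi) = -1 alone: the order of z divides 2^(n+1) but not 2^n. *)
Lemma expi_prim_root n : (2 ^ n.+1).-primitive_root (expi (pi / 2 ^+ n : R)).
Proof.
set z := expi _.
have z2n : z ^+ (2 ^ n) = -1.
  rewrite -expi_nat natrX mulrC divfK ?expf_neq0 ?pnatr_eq0//.
  by rewrite expiE cospi sinpi -[in RHS](rmorph1 (real_complex R)); simpc.
have zN : z ^+ (2 ^ n.+1) = 1 by rewrite expnSr exprM z2n sqrrN expr1n.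
have [m prim_m] := prim_order_exists (expn_gt0 2 n.+1) zN.
move=> /(dvdn_pfactor _ _ (isT : prime 2))[i + mE]; rewrite mE in prim_m.
rewrite leq_eqVlt => /orP[/eqP <-//|]; rewrite ltnS => in_.
have : z ^+ (2 ^ n) = 1.
  by rewrite -(subnKC in_) expnD exprM (prim_expr_order prim_m) expr1n.
rewrite z2n => /eqP; rewrite -subr_eq0 -opprD oppr_eq0 -[1 + 1]/(2%:R).
by rewrite pnatr_eq0.
Qed.

Lemma sum_prim_root_expr (N m : nat) (z : R[i]) : N.-primitive_root z ->
  \sum_(j < N) (z ^+ j) ^+ m = if (N %| m)%N then N%:R else 0.
Proof.
move=> prim; case: ifPn => [/dvdnP[q ->]|ndiv].
  under eq_bigr do rewrite -exprM mulnA mulnC exprM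
    (prim_expr_order prim) expr1n.
  by rewrite sumr_const card_ord.
under eq_bigr do rewrite -exprM mulnC exprM.
have : (z ^+ m - 1) * \sum_(j < N) (z ^+ m) ^+ j = 0.
  by rewrite -subrX1 -exprM mulnC exprM (prim_expr_order prim) expr1n subrr.
move=> /eqP; rewrite mulf_eq0 subr_eq0 -(prim_order_dvd prim) (negbTE ndiv).
by move=> /eqP.
Qed.

(** Cauchy's estimate on the unit circle. The Fourier integral is replaced by
    the mean over the N-th roots of unity, which isolates the coefficients of
    index k modulo N; for N large these are the k-th one and a small tail. *)
Lemma cauchy_estimate_circle c (F : R -> R[i]) (M : R) : abs_summable c ->
  (forall t, ccvg (fun N => \sum_(k < N) (c k)%:C * expi t ^+ k) (F t)) ->
  (forall t, cmod (F t) <= M) -> forall k, `|c k| <= M.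
Proof.
move=> c_sum cF FM k; apply/ler_addgt0Pr => e e0.
have e2 : 0 < e / 2 by lra.
have [M0 tail] := abs_summable_tail c_sum e2.
pose n := maxn k M0; pose N := (2 ^ n.+1)%N; set z := expi (pi / 2 ^+ n : R).
have prim : N.-primitive_root z := expi_prim_root n.
have nN : (n < N)%N by apply: leq_trans (ltn_expl _ (isT : 1 < 2)%N).
have kN : (k < N)%N by apply: leq_ltn_trans (leq_maxl _ _) nN.
have M0N : (M0 <= N)%N by apply: leq_trans (leq_maxr k _) (ltnW nN).
have N0 : (0 < N)%N by rewrite expn_gt0.
have zj j : z ^+ j = expi (j%:R * (pi / 2 ^+ n)) by rewrite expi_nat.
pose S L j := \sum_(m < L) (c m)%:C * (z ^+ j) ^+ m.
have : \forall L \near \oo, forall j : 'I_N, cmod (S L j) <= M + e / 2.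
  apply: filter_forall => j.
  have /ccvgP/(_ _ e2) := cF (j%:R * (pi / 2 ^+ n)).
  apply: filterS => L; rewrite -zj -/(S L j) => h.
  have := cmodD (S L j - F (j%:R * (pi / 2 ^+ n))) (F (j%:R * (pi / 2 ^+ n))).
  by rewrite subrK; have := FM (j%:R * (pi / 2 ^+ n)); lra.
move=> [L0 _ /(_ (maxn L0 N) (leq_maxl _ _))] /=.
set L := maxn L0 N => hL; have NL : (N <= L)%N by exact: leq_maxr.
have mean : \sum_(j < N) (z ^+ j) ^+ (N - k) * S L j =
    N%:R * \sum_(m < L | (N %| N - k + m)%N) (c m)%:C.
  under eq_bigr do rewrite mulr_sumr.
  rewrite exchange_big /= mulr_sumr [RHS]big_mkcond; apply: eq_bigr => m _.
  under eq_bigr do rewrite mulrCA -exprD.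
  rewrite -mulr_sumr (sum_prim_root_expr _ prim) mulrC.
  by case: ifP => // _; rewrite mul0r.
have split : \sum_(m < L | (N %| N - k + m)%N) (c m)%:C =
    (c k)%:C + \sum_(N <= m < L | (N %| N - k + m)%N) (c m)%:C.
  rewrite -(big_mkord (fun m => N %| N - k + m)%N (fun m => (c m)%:C)).
  rewrite (big_cat_nat (leq0n N) NL) /= big_mkord; congr (_ + _).
  rewrite (big_pred1 (Ordinal kN)) // => m /=; apply/idP/eqP => [|->].
    move=> h; apply: val_inj => /=; move: h.
    have [mk|km] := leqP k m.
      rewrite -{1}(subnKC mk) addnA subnK ?(ltnW kN)// dvdn_addr//.
      move=> /dvdn_leq h; apply/eqP; rewrite eqn_leq mk andbT -subn_eq0.
      rewrite -leqn0 leqNgt; apply/negP => /h; rewrite leqNgt => /negP; apply.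
      exact: leq_ltn_trans (leq_subr _ _) (ltn_ord m).
    rewrite gtnNdvd// ?addn_gt0 ?subn_gt0 ?kN//.
    by rewrite -ltn_subRL subKn ?(ltnW kN).
  by rewrite /= subnK// ltnW.
have ck : N%:R * cmod (c k)%:C <= N%:R * (M + e).
  have -> : N%:R * cmod (c k)%:C = cmod (N%:R * (c k)%:C).
    by rewrite cmodM cmod_nat.
  have -> : N%:R * (c k)%:C = \sum_(j < N) (z ^+ j) ^+ (N - k) * S L j -
       N%:R * \sum_(N <= m < L | (N %| N - k + m)%N) (c m)%:C.
    by rewrite mean split mulrDr addrK.
  apply: le_trans (cmodB _ _) _.
  rewrite (_ : N%:R * (M + e) = N%:R * (M + e / 2) + N%:R * (e / 2)); last first.
    by rewrite -mulrDr; congr (_ * _); lra.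
  apply: lerD.
    apply: le_trans (cmod_sum _ _ _) _.
    rewrite mulr_natl -[in leRHS](card_ord N) -sumr_const; apply: ler_sum => j _.
    by rewrite cmodM !cmodX cmod_expi !expr1n mul1r.
  rewrite cmodM cmod_nat.
  apply: ler_wpM2l => //; apply: le_trans (cmod_sum _ _ _) _.
  apply: le_trans (tail N L M0N); rewrite big_mkcond.
  by apply: ler_sum => m _; case: ifP => _; rewrite ?cmod_real.
by move: ck; rewrite ler_pM2l ?ltr0n// cmod_real.
Qed.

End CauchyEstimate.

(** * Generating functions *)

Section GeneratingFunctions.
Variable R : realType.
Implicit Types (c d : nat -> R) (f g : R[i] -> R[i]) (rho x t : R) (z w : R[i]).

(** f is the sum, on the closed disc of radius rho, of the power series with
    coefficients c, and the convergence is absolute up to the boundary. The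
    function f is part of the relation, rather than a limit computed from c, so
    that products and exponentials are identified by rewriting. *)
Definition gf rho c f :=
  abs_summable (fun k => c k * rho ^+ k) /\
  forall w, cmod w <= rho -> ccvg (fun N => \sum_(k < N) (c k)%:C * w ^+ k) (f w).

Lemma gf_summable_at rho c w : abs_summable (fun k => c k * rho ^+ k) ->
  cmod w <= rho -> abs_summable (fun k => cmod ((c k)%:C * w ^+ k)).
Proof.
move=> [B cB] w_rho; exists B => N; apply: le_trans (cB N).
apply: ler_sum => k _; rewrite ger0_norm ?cmod_ge0// cmodM cmod_real cmodX normrM.
apply: ler_wpM2l => //; rewrite normrX lerXn2r ?nnegrE ?cmod_ge0//.
by apply: le_trans w_rho _; exact: ler_norm.
Qed.

Lemma gf_abs_summable c (f : R[i] -> R[i]) : gf 1 c f -> abs_summable c.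
Proof.
move=> [[B cB] _]; exists B => N; have := cB N.
by under eq_bigr do rewrite expr1n mulr1.
Qed.

Lemma eq_gf rho c f g : (forall w, cmod w <= rho -> f w = g w) ->
  gf rho c f -> gf rho c g.
Proof. by move=> fg [cs cf]; split=> // w wr; rewrite -fg//; exact: cf. Qed.

Lemma gfW rho' rho c f : 0 <= rho' -> rho' <= rho -> gf rho c f -> gf rho' c f.
Proof.
move=> r0 rr [[B cB] cf]; split=> [|w w_r]; last first.
  by apply: cf; exact: le_trans rr.
exists B => N; apply: le_trans (cB N); apply: ler_sum => k _.
rewrite !normrM ler_wpM2l// !normrX !ger0_norm ?(le_trans r0)//.
by rewrite lerXn2r ?nnegrE ?(le_trans r0).
Qed.

Lemma gfD rho c d f g : gf rho c f -> gf rho d g ->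
  gf rho (fun k => c k + d k) (fun w => f w + g w).
Proof.
move=> [[B cB] cf] [[D dD] dg]; split=> [|w wr].
  exists (B + D) => N; apply: le_trans (lerD (cB N) (dD N)).
  by rewrite -big_split /=; apply: ler_sum => k _; rewrite mulrDl ler_normD.
have := ccvgD (cf w wr) (dg w wr); congr ccvg; apply/funext => N.
by rewrite -big_split; apply: eq_bigr => k _ /=; rewrite rmorphD mulrDl.
Qed.

Lemma gfZ rho c f x : gf rho c f ->
  gf rho (fun k => x * c k) (fun w => x%:C * f w).
Proof.
move=> [[B cB] cf]; split=> [|w wr].
  exists (`|x| * B) => N; apply: le_trans (ler_wpM2l (normr_ge0 x) (cB N)).
  by rewrite mulr_sumr; apply: ler_sum => k _; rewrite -mulrA normrM.
have := ccvgM (ccvg_cst (z := x%:C)) (cf w wr); congr ccvg; apply/funext => N.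
by rewrite mulr_sumr; apply: eq_bigr => k _ /=; rewrite rmorphM mulrA.
Qed.

Lemma gfB rho c d f g : gf rho c f -> gf rho d g ->
  gf rho (fun k => c k - d k) (fun w => f w - g w).
Proof.
move=> hc /(gfZ (-1)) hd; have := gfD hc hd.
rewrite (_ : (fun k => _) = (fun k => c k - d k)); last first.
  by apply/funext => k; rewrite mulN1r.
by apply: eq_gf => w _; rewrite rmorphN1 mulN1r.
Qed.

Lemma gf0 rho : gf rho (fun=> 0) (fun=> 0).
Proof.
split=> [|w _].
  by exists 0 => N; rewrite big1// => k _; rewrite mul0r normr0.
rewrite (_ : (fun N => _) = (fun=> 0)); first exact: ccvg_cst.
by apply/funext => N; rewrite big1// => k _; rewrite mul0r.
Qed.

Lemma gf_sum rho (n : nat) (c : nat -> nat -> R) (f : nat -> R[i] -> R[i]) :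
  (forall s, gf rho (c s) (f s)) ->
  gf rho (fun k => \sum_(s < n) c s k) (fun w => \sum_(s < n) f s w).
Proof.
move=> cf; elim: n => [|n IH].
  under eq_fun do rewrite big_ord0.
  by apply: eq_gf (gf0 rho) => w _; rewrite big_ord0.
under eq_fun do rewrite big_ord_recr /=.
by apply: eq_gf (gfD IH (cf n)) => w _; rewrite big_ord_recr.
Qed.

Lemma gf_conv rho c d f g : gf rho c f -> gf rho d g ->
  gf rho (conv c d) (fun w => f w * g w).
Proof.
move=> [cs cf] [ds dg]; split=> [|w wr].
  have [[B cB] [D dD]] := (cs, ds); exists (B * D) => N.
  have := conv_bound (c := fun k => c k * rho ^+ k)
    (d := fun k => d k * rho ^+ k) cB dD N.
  congr (_ <= _); apply: eq_bigr => n _; congr `|_|.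
  rewrite /conv mulr_suml.
  apply: eq_bigr => k _; by rewrite mulrACA -exprD subnKC// -ltnS.
have := ccvg_conv (gf_summable_at cs wr) (gf_summable_at ds wr) (cf w wr) (dg w wr).
congr ccvg; apply/funext => N; apply: eq_bigr => n _.
rewrite rmorph_sum mulr_suml; apply: eq_bigr => k _.
by rewrite rmorphM mulrACA -exprD subnKC// -ltnS.
Qed.

Lemma gf_finite rho c n : 0 <= rho -> (forall k, (n <= k)%N -> c k = 0) ->
  gf rho c (fun w => \sum_(k < n) (c k)%:C * w ^+ k).
Proof.
move=> r0 c0; have trunc (V : nmodType) (F : nat -> V) N :
    (forall k, (n <= k)%N -> F k = 0) -> (n <= N)%N ->
    \sum_(k < N) F k = \sum_(k < n) F k.
  move=> F0 nN; rewrite -!(big_mkord xpredT F) (big_cat_nat (leq0n n) nN) /=.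
  by rewrite [X in _ + X]big_nat_cond [X in _ + X]big1 ?addr0// => k /andP[/andP[/F0]].
split=> [|w _].
  exists (\sum_(k < n) `|c k * rho ^+ k|) => N.
  have [nN|Nn] := leqP n N.
    rewrite (trunc _ (fun k => `|c k * rho ^+ k|))// => k /c0 ->.
    by rewrite mul0r normr0.
  rewrite -!(big_mkord xpredT (fun k => `|c k * rho ^+ k|)).
  by rewrite [leRHS](big_cat_nat (leq0n N) (ltnW Nn)) /= lerDl sumr_ge0.
apply/ccvgP => e e0; exists n => // N /= nN.
rewrite (trunc _ (fun k => (c k)%:C * w ^+ k))// ?subrr ?cmod0// => k /c0 ->.
by rewrite rmorph0 mul0r.
Qed.

(** Coefficients of the polynomial x + t w. *)
Definition lin x t k : R := match k with 0%N => x | 1%N => t | _ => 0 end.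

Lemma gf_lin rho x t : 0 <= rho -> gf rho (lin x t) (fun w => x%:C + t%:C * w).
Proof.
move=> r0; apply: eq_gf (@gf_finite rho (lin x t) 2 r0 _) => [w _|[|[|]]//].
by rewrite !big_ord_recl big_ord0 /= expr0 mulr1 expr1 addr0.
Qed.

Lemma conv_linS x t c k : conv (lin x t) c k.+1 = x * c k.+1 + t * c k.
Proof.
rewrite /conv !big_ord_recl /= subn0 subSS subn0 big1 ?addr0// => i _.
by rewrite mul0r.
Qed.

Lemma conv_lin0 x t c : conv (lin x t) c 0 = x * c 0%N.
Proof. by rewrite /conv big_ord_recl big_ord0 addr0. Qed.

(** Coefficients of e^(x w). *)
Definition expo x k : R := (k`!%:R)^-1 * x ^+ k.

Lemma gf_expo rho x : 0 <= rho -> gf rho (expo x) (fun w => cexp (x%:C * w)).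
Proof.
move=> r0; split=> [|w _].
  exists (expR `|x * rho|) => N; apply: le_trans (abs_summable_exp (x * rho) N).
  by rewrite le_eqVlt; apply/orP; left; apply/eqP/eq_bigr => k _;
    rewrite /expo exprMn mulrA.
have := ccvg_cexp (z := x%:C * w); congr ccvg; apply/funext => N.
by apply: eq_bigr => k _; rewrite /expo rmorphM rmorphXn exprMn mulrA.
Qed.

Lemma gf_cauchy rho c f (M : R) : 0 <= rho -> gf rho c f ->
  (forall w, cmod w <= rho -> cmod (f w) <= M) ->
  forall k, `|c k| * rho ^+ k <= M.
Proof.
move=> r0 [cs cf] fM k.
have wr t : cmod (rho%:C * expi t) <= rho.
  by rewrite cmodM cmod_expi mulr1 cmod_real ger0_norm.
rewrite -{1}(ger0_norm (exprn_ge0 k r0)) -normrM.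
apply: (@cauchy_estimate_circle _ (fun k => c k * rho ^+ k)
  (fun t => f (rho%:C * expi t)) M cs) => t; last exact: fM.
have := cf _ (wr t); congr ccvg; apply/funext => N; apply: eq_bigr => j _.
by rewrite exprMn rmorphM rmorphXn mulrA.
Qed.

(** Every identity between convolutions used below is obtained by comparing
    values of generating functions on the unit disc. *)
Lemma gf_inj c d f : gf 1 c f -> gf 1 d f -> c = d.
Proof.
move=> cf df; apply/funext => k; apply/subr0_eq/eqP; rewrite -normr_le0.
have h : `|c k - d k| * 1 ^+ k <= 0.
  by apply: (gf_cauchy ler01 (gfB cf df)) => w _; rewrite subrr cmod0.
by rewrite expr1n mulr1 in h.
Qed.

End GeneratingFunctions.

(** * Poisson laws and their differences *)

Section Poisson.
Variable R : realType.
Implicit Types (c d beta : nat -> R) (x t lambda tau : R) (w : R[i]).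

Definition pois t k := expR (- t) * expo t k.

Lemma gf_pois rho t : 0 <= rho -> gf rho (pois t) (fun w => cexp (t%:C * (w - 1))).
Proof.
move=> r0; apply: eq_gf (gfZ (expR (- t)) (gf_expo t r0)) => w _.
rewrite mulrBr mulr1 addrC cexpD; congr (_ * _).
by rewrite /cexp /= oppr0 cos0 sin0 mulr1.
Qed.

Lemma pois_ge0 t k : 0 <= t -> 0 <= pois t k.
Proof. by move=> t0; rewrite !mulr_ge0 ?expR_ge0 ?invr_ge0 ?exprn_ge0. Qed.

Lemma poisS t k : pois t k.+1 = pois t k * (t / k.+1%:R).
Proof. by rewrite /pois /expo factS natrM invfM exprSr; ring. Qed.

Lemma sum_pois_le1 t N : 0 <= t -> \sum_(k < N) `|pois t k| <= 1.
Proof.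
move=> t0; have := abs_summable_exp t N; rewrite (ger0_norm t0) => h.
have -> : 1 = expR (- t) * expR t by rewrite -expRD addNr expR0.
apply: le_trans (ler_wpM2l (expR_ge0 _) h).
rewrite mulr_sumr; apply: ler_sum => k _.
by rewrite normrM (ger0_norm (expR_ge0 _)).
Qed.

(** A backward difference, that is multiplication of the generating function by
    w - 1. *)
Definition bdiff c := conv (lin (-1) 1) c.

Lemma gf_bdiff rho c f : 0 <= rho -> gf rho c f ->
  gf rho (bdiff c) (fun w => (w - 1) * f w).
Proof.
move=> r0 cf; apply: eq_gf (gf_conv (gf_lin _ _ r0) cf) => w _.
by rewrite rmorphN1 rmorph1 mul1r addrC.
Qed.

Lemma gf_iter_bdiff rho c f s : 0 <= rho -> gf rho c f ->
  gf rho (iter s bdiff c) (fun w => (w - 1) ^+ s * f w).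
Proof.
move=> r0 cf; elim: s => [|s IH] /=.
  by apply: eq_gf cf => w _; rewrite mul1r.
by apply: eq_gf (gf_bdiff r0 IH) => w _; rewrite exprS mulrA.
Qed.

Lemma bdiff_pois t k : t != 0 -> bdiff (pois t) k = pois t k * (k%:R / t - 1).
Proof.
move=> t0; case: k => [|k]; rewrite /bdiff.
  by rewrite conv_lin0 mul0r add0r mulrN1 mulN1r.
rewrite conv_linS poisS; have : k.+1%:R != 0 :> R by rewrite pnatr_eq0.
by move: (k.+1%:R) => a a0; field; rewrite t0 a0.
Qed.

(** The truncated variance of the Poisson law is explicit, and the correction
    term has the right sign as soon as the truncation passes the mean. *)
Lemma pois_variance_partial t N : t != 0 ->
  \sum_(k < N) pois t k * (k%:R / t - 1) ^+ 2 =
  (\sum_(k < N) pois t k) / t - pois t N * (N%:R / t) * (N%:R / t - 1).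
Proof.
move=> t0; elim: N => [|N IH]; first by rewrite !big_ord0; ring.
rewrite !big_ord_recr /= IH poisS -natr1.
have : N%:R + 1 != 0 :> R by rewrite natr1 pnatr_eq0.
by move: (N%:R) => a a0; field; rewrite t0 a0.
Qed.

Lemma pois_variance t N : 0 < t ->
  \sum_(k < N) pois t k * (k%:R / t - 1) ^+ 2 <= t^-1.
Proof.
move=> t0; have t0' := ltW t0.
pose M := maxn N (Num.truncn t).+1.
apply: le_trans (_ : \sum_(k < M) pois t k * (k%:R / t - 1) ^+ 2 <= _).
  rewrite -!(big_mkord xpredT (fun k => pois t k * (k%:R / t - 1) ^+ 2)).
  rewrite [leRHS](big_cat_nat (leq0n N) (leq_maxl _ _)) /= lerDl.
  by apply: sumr_ge0 => k _; rewrite mulr_ge0 ?pois_ge0 ?sqr_ge0.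
rewrite pois_variance_partial ?gt_eqF//.
have tM : t <= M%:R.
  apply: ltW; apply: lt_le_trans (truncnS_gt t) _; rewrite ler_nat leq_maxr//.
have h : 0 <= pois t M * (M%:R / t) * (M%:R / t - 1).
  apply: mulr_ge0; first by rewrite mulr_ge0 ?divr_ge0 ?pois_ge0.
  by rewrite subr_ge0 ler_pdivlMr// mul1r.
have S1 : \sum_(k < M) pois t k <= 1.
  by apply: le_trans (sum_pois_le1 M t0'); apply: ler_sum => k _; exact: ler_norm.
apply: le_trans (_ : (\sum_(k < M) pois t k) / t <= _); first by rewrite gerBl.
by rewrite -[leRHS]mul1r ler_wpM2r// invr_ge0.
Qed.

(** As [bdiff_pois] shows, the left-hand side is the mean absolute deviation of
    the Poisson law divided by t, which Cauchy-Schwarz bounds by the standard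
    deviation; Cauchy-Schwarz takes here the form 2|y| <= q y^2 + 1/q. *)
Lemma bdiff_pois_bound t N : 0 < t ->
  \sum_(k < N) `|bdiff (pois t) k| <= (Num.sqrt t)^-1.
Proof.
move=> t0; set q := Num.sqrt t; have q0 : 0 < q by rewrite sqrtr_gt0.
have tq : t^-1 = q^-1 * q^-1 by rewrite -invfM -expr2 sqr_sqrtr ?ltW.
have amgm y : `|y| <= 2^-1 * (q * y ^+ 2 + q^-1).
  have : 0 <= q^-1 * (q * `|y| - 1) ^+ 2 by rewrite mulr_ge0 ?sqr_ge0 ?invr_ge0 ?ltW.
  have -> : q^-1 * (q * `|y| - 1) ^+ 2 = q * y ^+ 2 + q^-1 - 2 * `|y|.
    by rewrite -(real_normK (num_real y)); field; rewrite gt_eqF.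
  by lra.
have h : \sum_(k < N) `|bdiff (pois t) k| <=
  2^-1 * (q * (\sum_(k < N) pois t k * (k%:R / t - 1) ^+ 2)
          + q^-1 * \sum_(k < N) `|pois t k|).
  rewrite !mulr_sumr -big_split /= mulr_sumr; apply: ler_sum => k _.
  rewrite bdiff_pois ?gt_eqF// normrM (ger0_norm (pois_ge0 k (ltW t0))).
  apply: le_trans (ler_wpM2l (pois_ge0 k (ltW t0)) (amgm _)) _.
  by rewrite le_eqVlt; apply/orP; left; apply/eqP; ring.
apply: le_trans h _.
have h1 := ler_wpM2l (ltW q0) (pois_variance N t0).
have h2 : q^-1 * \sum_(k < N) `|pois t k| <= q^-1 * 1.
  by apply: ler_wpM2l; [rewrite invr_ge0 ltW | exact: sum_pois_le1 (ltW t0)].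
have tq' : q * t^-1 = q^-1 by rewrite tq mulrA divff ?mul1r ?gt_eqF.
rewrite tq' in h1.
lra.
Qed.

(** (w - 1)^s e^(s t (w - 1)) is the s-th power of (w - 1) e^(t (w - 1)). *)
Lemma iter_bdiff_pois_bound t s N : 0 < t ->
  \sum_(k < N) `|iter s bdiff (pois (s%:R * t)) k| <= (Num.sqrt t)^-1 ^+ s.
Proof.
move=> t0; elim: s N => [|s IH] N; first by rewrite mul0r sum_pois_le1.
have -> : iter s.+1 bdiff (pois (s.+1%:R * t)) =
    conv (bdiff (pois t)) (iter s bdiff (pois (s%:R * t))).
  have g1 := gf_iter_bdiff s.+1 ler01 (gf_pois (s.+1%:R * t) ler01).
  have g2 := gf_conv (gf_bdiff ler01 (gf_pois t ler01))
    (gf_iter_bdiff s ler01 (gf_pois (s%:R * t) ler01)).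
  apply: gf_inj g1 _; apply: eq_gf g2 => w _.
  have -> : (s.+1%:R * t)%:C = t%:C + (s%:R * t)%:C.
    by rewrite -natr1 mulrDl mul1r addrC; exact: (rmorphD (real_complex R)).
  by move: (w - 1) => u; rewrite mulrDl cexpD exprS mulrACA.
rewrite exprS; apply: conv_bound => M; last exact: IH.
exact: bdiff_pois_bound.
Qed.

(** Coefficients of e^(lambda (w - 1)) sum_(s < S) beta_s (w - 1)^s; the scheme of
    order r is the case S = r + 1. *)
Definition scheme lambda beta S k :=
  \sum_(s < S) beta s * iter s bdiff (pois lambda) k.

Lemma gf_scheme rho lambda beta S : 0 <= rho ->
  gf rho (scheme lambda beta S)
    (fun w => cexp (lambda%:C * (w - 1)) * \sum_(s < S) (beta s)%:C * (w - 1) ^+ s).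
Proof.
move=> r0.
have := gf_sum S (fun s => gfZ (beta s)
  (gf_iter_bdiff s r0 (gf_pois lambda r0))).
apply: eq_gf => w _; rewrite mulr_sumr; apply: eq_bigr => s _.
by rewrite mulrA mulrC.
Qed.

(** The l1 norm s^(s/2) / lambda^(s/2) of (w - 1)^s e^(lambda (w - 1)) cancels the
    factor s^(-s/2) in the bound for beta_s, which leaves the geometric series of
    ratio x = tau / sqrt lambda < 1/4. Its sum x^r / (1 - x) is at most
    2 (4 x)^r. *)
Lemma scheme_tail lambda tau beta r S N : 0 < lambda -> 0 <= tau ->
  4 * tau / Num.sqrt lambda < 1 -> (0 < r)%N ->
  (forall s, (r <= s)%N -> `|beta s| <= (tau / Num.sqrt s%:R) ^+ s) ->
  (r <= S)%N ->
  \sum_(k < N) `|scheme lambda beta S k - scheme lambda beta r k|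
    <= 2 * (4 * tau / Num.sqrt lambda) ^+ r.
Proof.
move=> l0 tau0 x1 r0 hbeta rS; set x := tau / Num.sqrt lambda.
have q0 : 0 < Num.sqrt lambda by rewrite sqrtr_gt0.
have x0 : 0 <= x by rewrite divr_ge0 ?(ltW q0).
have x4 : 4 * tau / Num.sqrt lambda = 4 * x by rewrite -mulrA.
rewrite x4 in x1 *.
have -> : \sum_(k < N) `|scheme lambda beta S k - scheme lambda beta r k| =
  \sum_(k < N) `|\sum_(r <= s < S) beta s * iter s bdiff (pois lambda) k|.
  apply: eq_bigr => k _; congr `|_|; rewrite /scheme.
  pose F s := beta s * iter s bdiff (pois lambda) k.
  rewrite -!(big_mkord xpredT F) (big_cat_nat (leq0n r) rS) /=.
  by rewrite addrAC subrr add0r.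
apply: le_trans (_ : \sum_(r <= s < S) x ^+ s <= _).
  apply: le_trans (_ : \sum_(k < N) \sum_(r <= s < S)
     `|beta s| * `|iter s bdiff (pois lambda) k| <= _).
    apply: ler_sum => k _; apply: le_trans (ler_norm_sum _ _ _) _.
    by apply: ler_sum => s _; rewrite normrM.
  rewrite exchange_big /=; apply: ler_sum_nat => s /andP[rs _].
  have s0 : 0 < s%:R :> R by rewrite ltr0n (leq_trans r0).
  rewrite -mulr_sumr.
  have := @iter_bdiff_pois_bound (lambda / s%:R) s N.
  rewrite divr_gt0// mulrC divfK ?gt_eqF// => /(_ isT) h.
  apply: le_trans (ler_pM (normr_ge0 _) _ (hbeta s rs) h) _.
    by apply: sumr_ge0.
  rewrite -exprMn le_eqVlt; apply/orP; left; apply/eqP; congr (_ ^+ _).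
  have sq0 : 0 < Num.sqrt (s%:R : R) by rewrite sqrtr_gt0.
  rewrite sqrtrM ?ltW// sqrtrV ?ltW// /x.
  by field; rewrite !gt_eqF.
rewrite -{1}[r]add0n big_addn big_mkord.
under eq_bigr do rewrite addnC exprD.
have x1' : x < 1 by lra.
apply: le_trans (sum_geometric_le _ (exprn_ge0 r x0) x0 x1') _.
rewrite mulrC ler_pM ?exprn_ge0 ?invr_ge0//; [lra| |].
  have -> : 2 = (2^-1)^-1 :> R by rewrite invrK.
  by rewrite lef_pV2 ?posrE; lra.
by rewrite lerXn2r ?nnegrE//; lra.
Qed.

End Poisson.

(** * Signed measures and expectations on the natural numbers *)

Section SignedMeasures.
Variable R : realType.
Implicit Types (c d beta : nat -> R) (nu : {charge set nat -> \bar R}).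

Lemma nneseries_le_bound (u : nat -> R) (B : R) : (forall k, 0 <= u k) ->
  (forall N, \sum_(k < N) u k <= B) -> (\sum_(k <oo) (u k)%:E <= B%:E)%E.
Proof.
move=> u0 uB; apply: lime_le.
  by apply: is_cvg_nneseries => k _ _; rewrite lee_fin.
by apply: nearW => N; rewrite sumEFin lee_fin big_mkord.
Qed.

Lemma abs_summable_integrable c : abs_summable c ->
  (@counting _ R : {measure set nat -> \bar R}).-integrable setT (EFin \o c).
Proof.
move=> [B cB]; apply/integrableP; split; first by [].
rewrite ge0_integral_count; last by move=> k; exact: abse_ge0.
apply: le_lt_trans (ltry B); exact: (nneseries_le_bound _ cB).
Qed.

(** The charge has density c with respect to the counting measure. *)
Lemma charge_of_abs_summable c : abs_summable c ->
  exists nu, forall k, nu [set k] = (c k)%:E.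
Proof.
move=> /abs_summable_integrable ci; exists (induced_charge ci) => k.
change (\int[@counting _ R]_(t in [set k]) (c t)%:E = (c k)%:E)%E.
rewrite (eq_integral (cst (c k)%:E)); last first.
  by move=> i; rewrite inE => ->.
rewrite integral_cst//= /counting asboolT; last exact: finite_set1.
by rewrite fset_set1 finmap.cardfs1 mule1.
Qed.

(** The point masses are dominated by those of the total variation of nu, a
    finite measure by the Hahn decomposition. *)
Lemma charge_abs_summable nu : abs_summable (fun k => fine (nu [set k])).
Proof.
have [P [Q PQ]] := Hahn_decomposition nu.
pose mu : {measure set nat -> \bar R} := charge_variation PQ.
have mu_fin : mu setT \is a fin_num.
  exact: (@fin_num_measure _ _ _ (charge_variation PQ)).
exists (fine (mu setT)) => N; rewrite -lee_fin fineK// -sumEFin.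
apply: le_trans (_ : (\sum_(k < N) mu [set nat_of_ord k] <= _)%E).
  apply: lee_sum => k _; apply: le_trans (abse_charge_variation PQ _) => //.
  by rewrite -abse_EFin fineK// fin_num_measure.
rewrite -measure_bigsetU//; last first.
  apply/trivIsetP => i j _ _ /eqP ij; apply/seteqP; split => // x [-> /=].
  by move/ij.
by apply: le_measure; rewrite ?inE.
Qed.

Lemma fourier_gf nu c (f : R[i] -> R[i]) : (forall k, nu [set k] = (c k)%:E) ->
  gf 1 c f -> forall xi, fourier nu xi = f (expi xi).
Proof.
move=> nuc [_ cf] xi; apply: ccvg_lim.
have := cf (expi xi); rewrite cmod_expi lexx => /(_ isT).
congr ccvg; apply/funext => N; apply: eq_bigr => k _.
by rewrite nuc expi_nat.
Qed.

(** The sequence c provides a charge with Fourier transform phi. Conversely the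
    point masses of any such charge are summable, and Cauchy's estimate applied to
    their difference with c, whose Fourier transform vanishes, identifies them. *)
Lemma signed_measure_of_fourierE c (f : R[i] -> R[i]) (phi : R -> R[i]) :
  gf 1 c f -> (forall xi, phi xi = f (expi xi)) ->
  forall k, signed_measure_of_fourier phi [set k] = (c k)%:E.
Proof.
move=> cf phif.
have c_sum := gf_abs_summable cf.
have ex : exists nu, forall xi, fourier nu xi = phi xi.
  have [nu nuc] := charge_of_abs_summable c_sum.
  by exists nu => xi; rewrite phif; exact: fourier_gf nuc cf xi.
rewrite /signed_measure_of_fourier; case: pselect => // h k.
case: (cid h) => nu /= nuphi {h ex}.
have nuE j : nu [set j] = (fine (nu [set j]))%:E.
  by rewrite fineK// fin_num_measure.
have nu_sum := charge_abs_summable nu.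
rewrite nuE; congr EFin; apply/subr0_eq/eqP; rewrite -normr_le0.
apply: (@cauchy_estimate_circle _ (fun k => fine (nu [set k]) - c k) (fun=> 0)).
- exact: abs_summableB.
- move=> xi.
  have [l hl] : exists l, ccvg (fun N => \sum_(k < N)
      (fine (nu [set nat_of_ord k]))%:C * expi xi ^+ k) l.
    apply: (@ccvg_abs_summable _ (fun k => (fine (nu [set k]))%:C * expi xi ^+ k)).
    have [B hB] := nu_sum; exists B => N.
    apply: le_trans (hB N); apply: ler_sum => j _.
    by rewrite cmodM cmod_real cmodX cmod_expi expr1n mulr1 normr_id.
  have hl' : fourier nu xi = l.
    rewrite /fourier; apply: ccvg_lim; move: hl; congr ccvg; apply/funext => N.
    by apply: eq_bigr => j _; rewrite expi_nat.
  have [_ /(_ (expi xi))] := cf; rewrite cmod_expi lexx => /(_ isT).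
  move=> /(ccvgB hl); rewrite -hl' nuphi phif subrr.
  congr ccvg; apply/funext => N; rewrite -sumrB; apply: eq_bigr => j _.
  by rewrite rmorphB mulrBl.
- by move=> t; rewrite cmod0.
Qed.

Lemma poisson_scheme_set1 lambda (b : nat -> R[i]) beta r :
  beta 0%N = 1 -> beta 1%N = 0 ->
  (forall s, (2 <= s)%N -> b s = (beta s)%:C) -> (1 <= r)%N ->
  forall k, poisson_scheme lambda b r [set k] = (scheme lambda beta r.+1 k)%:E.
Proof.
move=> b0 b1 bs r1; apply: signed_measure_of_fourierE.
  exact: (gf_scheme lambda beta r.+1 ler01).
move=> xi; congr (_ * _).
rewrite -(big_mkord xpredT (fun s => (beta s)%:C * (expi xi - 1) ^+ s)).
rewrite [RHS](@big_cat_nat _ _ _ 2) //=; congr (_ + _).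
  by rewrite big_nat_recr//= big_nat1 b0 b1 rmorph0 mul0r addr0 mulr1.
by apply: eq_big_nat => s /andP[s2 _]; rewrite bs.
Qed.

Lemma dTV_le (mu nu : set nat -> \bar R) (p q : nat -> R) (B : R) :
  (forall k, mu [set k] = (p k)%:E) -> (forall k, nu [set k] = (q k)%:E) ->
  (forall N, \sum_(k < N) `|p k - q k| <= 2 * B) -> (dTV mu nu <= B%:E)%E.
Proof.
move=> mup nuq h; rewrite /dTV.
have -> : B%:E = ((2^-1)%:E * (2 * B)%:E)%E :> \bar R.
  by rewrite -EFinM mulrA mulVf ?mul1r.
rewrite lee_pmul2l ?lte_fin ?invr_gt0//.
under eq_eseriesr do rewrite mup nuq -EFinB abse_EFin.
exact: nneseries_le_bound.
Qed.

End SignedMeasures.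

Section Expectation.
Variable R : realType.

Lemma integral_nat_series (mu : probability nat R) (f : nat -> R) :
  mu.-integrable setT (EFin \o f) ->
  abs_summable (fun k => fine (mu [set k]) * f k) /\
  (fun N => \sum_(k < N) fine (mu [set nat_of_ord k]) * f k) @ \oo -->
    fine (\int[mu]_k (f k)%:E).
Proof.
move=> fi.
have m1 (k : nat) : measurable [set k] by [].
have tI : trivIset [set: nat] (fun k : nat => [set k]).
  by apply/trivIsetP => i j _ _ /eqP ij; apply/seteqP; split => // x [-> /= /ij].
have UT : \bigcup_k [set k] = [set: nat] by apply/seteqP; split => // k _; exists k.
have atom k : (\int[mu]_(x in [set k]) (f x)%:E)%E = (fine (mu [set k]) * f k)%:E.
  rewrite (eq_integral (cst (f k)%:E)); last by move=> i; rewrite inE => ->.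
  by rewrite integral_cst//= EFinM fineK ?fin_num_measure// muleC.
rewrite -UT in fi; have := integrable_summable tI m1 fi.
have := integral_bigcup tI m1 fi; rewrite UT.
under eq_eseriesr do rewrite atom.
move=> -> hs; have {hs}sum : abs_summable (fun k => fine (mu [set k]) * f k).
  move: hs; rewrite /summable -nneseries_esumT; last by move=> k; exact: abse_ge0.
  under eq_eseriesr do rewrite atom abse_EFin.
  set s := (\sum_(_ <oo) _)%E => s_fin; exists (fine s) => N.
  have s0 : (0 <= s)%E by apply: nneseries_ge0 => k _ _; rewrite lee_fin.
  rewrite -lee_fin fineK; last by rewrite ge0_fin_numE.
  rewrite -sumEFin -(big_mkord xpredT (fun k => `|fine (mu [set k]) * f k|%:E)).
  by apply: nneseries_lim_ge => k _ _; rewrite lee_fin.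
split=> //; have cv : cvgn (series (fun k => fine (mu [set k]) * f k)).
  apply: normed_cvg; apply: nondecreasing_is_cvgn.
    by apply/nondecreasing_seqP => n; rewrite /= /series /= big_nat_recr //= lerDl.
  by have [B hB] := sum; exists B => _ [n _ <-]; rewrite /= /series /= big_mkord.
rewrite (_ : (fun N => _) = series (fun k => fine (mu [set k]) * f k)); last first.
  by apply/funext => N; rewrite /series /= big_mkord.
have -> : (\sum_(k <oo) (fine (mu [set k]) * f k)%:E)%E =
    limn (EFin \o series (fun k => fine (mu [set k]) * f k)).
  by congr (limn _); apply/funext => n; rewrite /series /= sumEFin.
by rewrite EFin_lim.
Qed.

Lemma cexpectation_series d (T : measurableType d) (P : probability T R)
    (X : {RV P >-> nat}) (g : nat -> R[i]) (p : nat -> R) :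
  (forall k, distribution P X [set k] = (p k)%:E) ->
  cintegrable P (fun t => g (X t)) ->
  abs_summable (fun k => p k * complex.Re (g k)) /\
  ccvg (fun N => \sum_(k < N) (p k)%:C * g k) (cexpectation P (fun t => g (X t))).
Proof.
move=> pE [gRe gIm].
have real_part (f : nat -> R) : P.-integrable setT (fun t => (f (X t))%:E) ->
    abs_summable (fun k => p k * f k) /\
    (fun N => \sum_(k < N) p k * f k) @ \oo --> fine 'E_P[fun t => f (X t)].
  move=> fi.
  have fd : (distribution P X).-integrable setT (fun k : nat => (f k)%:E).
    by apply: integrable_pushforward => //; rewrite preimage_setT.
  have := integral_nat_series fd.
  have -> : (\int[distribution P X]_k (f k)%:E = 'E_P[fun t => f (X t)])%E.
    rewrite unlock.
    by apply: (@integral_distribution _ _ _ _ _ _ X (fun k : nat => (f k)%:E)).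
  have pE' k : fine (distribution P X [set k]) = p k by rewrite pE.
  by under eq_fun do rewrite pE'; under [X in X @ _ --> _]eq_fun do
     under eq_bigr do rewrite pE'.
have [sRe lRe] := real_part (fun k => complex.Re (g k)) gRe.
have [_ lIm] := real_part (fun k => complex.Im (g k)) gIm.
split=> //; apply: ccvg_ReIm => /=.
  suff h N : complex.Re (\sum_(k < N) (p k)%:C * g k) =
      \sum_(k < N) p k * complex.Re (g k) by rewrite (funext h).
  elim: N => [|N IH]; first by rewrite !big_ord0.
  by rewrite !big_ord_recr /= ReD IH; case: (g N) => x y /=; rewrite mul0r subr0.
suff h N : complex.Im (\sum_(k < N) (p k)%:C * g k) =
    \sum_(k < N) p k * complex.Im (g k) by rewrite (funext h).
elim: N => [|N IH]; first by rewrite !big_ord0.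
by rewrite !big_ord_recr /= ImD IH; case: (g N) => x y /=; rewrite mul0r addr0.
Qed.
End Expectation.

(** * Expansions in powers of w - 1 on the circle *)

Section PartOne.
Variable R : realType.
Implicit Types (beta p : nat -> R) (lambda tau : R).

Lemma fact_le_expn (n m : nat) : (n <= m)%N -> (n`! <= m ^ n)%N.
Proof.
by elim: n => [|n IH] nm //; rewrite factS expnS leq_mul// IH// ltnW.
Qed.

Lemma expr_fact_le (x : R) s : 0 <= x -> x ^+ s / s`!%:R <= expR x.
Proof.
move=> x0; have := abs_summable_exp x s.+1; rewrite (ger0_norm x0).
apply: le_trans; rewrite big_ord_recr /= mulrC; apply: le_trans (ler_norm _) _.
by rewrite lerDr sumr_ge0.
Qed.

(** With y = 2 rho tau, the claim is (y / sqrt s)^s <= exp (y^2), and the square of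
    the left-hand side is (y^2)^s / s^s <= (y^2)^s / s! <= exp (y^2), where
    exp (y^2) >= 1. *)
Lemma decay_le_geometric tau (rho : R) s : 0 <= tau -> 0 <= rho ->
  (tau / Num.sqrt s%:R) ^+ s * rho ^+ s
    <= expR ((2 * rho * tau) ^+ 2) * 2^-1 ^+ s.
Proof.
move=> tau0 rho0; set y := 2 * rho * tau; set q := Num.sqrt (s%:R : R).
have y0 : 0 <= y by rewrite /y !mulr_ge0.
have q0 : 0 <= q by exact: sqrtr_ge0.
have -> : (tau / q) ^+ s * rho ^+ s = (y / q) ^+ s * 2^-1 ^+ s.
  by rewrite -!exprMn; congr (_ ^+ s); rewrite /y; move: (q^-1) => qi; field.
apply: ler_wpM2r; first by rewrite exprn_ge0.
set v := (y / q) ^+ s; have v0 : 0 <= v by rewrite exprn_ge0 ?divr_ge0.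
have E1 : 1 <= expR (y ^+ 2) by rewrite -[leLHS]expR0 ler_expR sqr_ge0.
suff vE : v ^+ 2 <= expR (y ^+ 2).
  have [v1|v1] := leP v 1; first exact: le_trans E1.
  by apply: le_trans vE; rewrite expr2 ler_peMl// (ltW v1).
have -> : v ^+ 2 = (y ^+ 2) ^+ s / s%:R ^+ s.
  by rewrite /v -exprM mulnC exprM expr_div_n (sqr_sqrtr (ler0n _ s)) expr_div_n.
apply: le_trans (expr_fact_le s (sqr_ge0 y)).
apply: ler_wpM2l; first by rewrite exprn_ge0 ?sqr_ge0.
case: s {q q0 v v0} => [|s]; first by rewrite expr0 fact0.
rewrite lef_pV2 ?posrE ?exprn_gt0 ?ltr0n ?fact_gt0//.
by rewrite -natrX ler_nat fact_le_expn.
Qed.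

Lemma expi_near1 (e : R) : 0 < e -> exists xi, 0 < cmod (expi xi - 1) <= e.
Proof.
move=> e0; have e2 : 0 < e / 2 by lra.
have : \forall x \near (0 : R), `|cos 0 - cos x| < e / 2 /\ `|sin 0 - sin x| < e / 2.
  apply: filterI.
    by have /cvgrPdist_lt/(_ _ e2) := @continuous_cos R 0.
  by have /cvgrPdist_lt/(_ _ e2) := @continuous_sin R 0.
move=> /nbhs_ballP[del /= del0 hdel].
pose x := Num.min (del / 2) 1.
have x0 : 0 < x by rewrite lt_min ltr01 andbT; lra.
have [hc hs] : `|cos 0 - cos x| < e / 2 /\ `|sin 0 - sin x| < e / 2.
  apply: hdel; rewrite /ball /= sub0r normrN gtr0_norm// gt_min.
  by apply/orP; left; lra.
have xpi : x < pi.
  have := pi_ge2 R; suff : x <= 1 by lra.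
  by rewrite ge_min lexx orbT.
have sx : 0 < sin x by rewrite sin_gt0_pi// x0.
have zE : expi x - 1 = (cos x - 1) +i* sin x.
  by rewrite expiE -(rmorph1 (real_complex R)); simpc.
exists x; rewrite zE; apply/andP; split.
  by apply: lt_le_trans (Im_le_cmod _); rewrite /= normr_gt0 gt_eqF.
apply: le_trans (cmod_le_ReIm _) _ => /=.
by move: hc hs; rewrite cos0 sin0 sub0r normrN [`|1 - _|]distrC; lra.
Qed.

(** Principle of isolated zeros: z = 0 is an accumulation point of the circle
    |z + 1| = 1, and for small z on it the first nonzero term would dominate. *)
Lemma power_series_circle_eq0 (u : nat -> R[i]) (M : R) :
  (forall s, cmod (u s) <= M) ->
  (forall xi : R, ccvg (fun N => \sum_(s < N) u s * (expi xi - 1) ^+ s) 0) ->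
  forall s, u s = 0.
Proof.
move=> uM u0; have M0 : 0 <= M by exact: le_trans (cmod_ge0 _) (uM 0%N).
elim/ltn_ind => s IH; apply: cmod_eq0; apply/eqP.
rewrite eq_le cmod_ge0 andbT; apply/ler_addgt0Pr => e e0; rewrite add0r.
pose e' := Num.min (e / (2 * M + 1)) 2^-1.
have M1 : 0 < 2 * M + 1 by lra.
have e'0 : 0 < e' by rewrite lt_min divr_gt0//= invr_gt0.
have [xi /andP[z0 ze]] := expi_near1 e'0.
have z_half : cmod (expi xi - 1) <= 2^-1.
  by apply: le_trans ze _; rewrite ge_min lexx orbT.
have := ccvg_geometric_tail (u := fun s => u s * (expi xi - 1) ^+ s) M0
  (cmod_ge0 _) z_half _ (u0 xi) s.+1.
rewrite sub0r cmodN big_ord_recr /= big1 ?add0r; last first.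
  by move=> j _; rewrite IH// mul0r.
rewrite cmodM cmodX => h.
have {h} : cmod (u s) * cmod (expi xi - 1) ^+ s <=
    2 * M * cmod (expi xi - 1) ^+ s.+1.
  by apply: h => k; rewrite cmodM cmodX ler_wpM2r// exprn_ge0// cmod_ge0.
rewrite exprS mulrA ler_pM2r ?exprn_gt0// => h; apply: le_trans h _.
have h1 : cmod (expi xi - 1) <= e / (2 * M + 1).
  by apply: le_trans ze _; rewrite ge_min lexx.
rewrite ler_pdivlMr// in h1.
by have := ltW z0; nra.
Qed.

Lemma cmod_cexp_circle_le1 lambda xi : 0 <= lambda ->
  cmod (cexp (lambda%:C * (expi xi - 1))) <= 1.
Proof.
move=> l0; rewrite cmod_cexp -expR0 ler_expR expiE -(rmorph1 (real_complex R)).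
simpc => /=; have := cos_le1 xi; nra.
Qed.

Lemma cexp_mulN (z : R[i]) : cexp z * cexp (- z) = 1.
Proof. by rewrite -cexpD subrr cexp0. Qed.

(** On the unit circle the two transforms differ by e^(lambda (w - 1)), which has
    modulus at most 1, times a tail of the series in z = w - 1, where |z| <= 2.
    Cauchy's estimate transfers this bound to the coefficients. *)
Lemma scheme_approx p lambda tau beta (F : R -> R[i]) : 0 <= lambda -> 0 <= tau ->
  abs_summable p ->
  (forall xi, ccvg (fun N => \sum_(k < N) (p k)%:C * expi xi ^+ k) (F xi)) ->
  (forall xi, ccvg (fun N => \sum_(s < N) (beta s)%:C * (expi xi - 1) ^+ s)
     (F xi * cexp (- lambda%:C * (expi xi - 1)))) ->
  (forall s, `|beta s| <= (tau / Num.sqrt s%:R) ^+ s) ->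
  exists2 M, 0 <= M &
    forall S k, `|p k - scheme lambda beta S k| <= M * 2^-1 ^+ S.
Proof.
move=> l0 tau0 p_sum pF betaF betaD.
pose M := expR ((2 * 2 * tau) ^+ 2) : R; have M0 : 0 <= M by exact: expR_ge0.
exists (2 * M); first by rewrite mulr_ge0.
move=> S k; move: k.
have gs := gf_scheme lambda beta S ler01.
pose G xi := F xi - cexp (lambda%:C * (expi xi - 1)) *
    \sum_(s < S) (beta s)%:C * (expi xi - 1) ^+ s.
apply: (@cauchy_estimate_circle _ (fun k => p k - scheme lambda beta S k) G).
- exact: abs_summableB p_sum (gf_abs_summable gs).
- move=> xi; have [_ /(_ (expi xi))] := gs; rewrite cmod_expi lexx => /(_ isT).
  move=> /(ccvgB (pF xi)); congr ccvg; apply/funext => N.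
  rewrite -sumrB; apply: eq_bigr => j _.
  by rewrite rmorphB mulrBl.
- move=> xi; set z := expi xi - 1.
  have -> : G xi = cexp (lambda%:C * z) * (F xi * cexp (- lambda%:C * z) -
      \sum_(s < S) (beta s)%:C * z ^+ s).
    rewrite mulrBr /G; congr (_ - _).
    by rewrite mulrCA mulNr cexp_mulN mulr1.
  rewrite cmodM -[leRHS]mul1r; apply: ler_pM; rewrite ?cmod_ge0//.
    exact: cmod_cexp_circle_le1.
  have z2 : cmod z <= 2.
    by apply: le_trans (cmodB _ _) _; rewrite cmod_expi cmod1; lra.
  apply: (ccvg_geometric_tail (u := fun s => (beta s)%:C * z ^+ s) M0 _ (lexx _)
    _ (betaF xi)); first by rewrite invr_ge0.
  move=> s; rewrite cmodM cmod_real cmodX.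
  apply: le_trans (decay_le_geometric s tau0 (ler0n _ 2)).
  by apply: ler_pM; rewrite ?exprn_ge0 ?cmod_ge0// lerXn2r ?nnegrE ?cmod_ge0.
Qed.

End PartOne.

(** * Total variation distance to a Poisson scheme *)

Section PartOneConclusion.
Variable R : realType.

(** Passage to the limit in the auxiliary order S. *)
Lemma sum_pow_half_le (a B : R) (M : R) r : 0 <= M ->
  (forall S, (r <= S)%N -> a <= M * 2^-1 ^+ S + B) -> a <= B.
Proof.
move=> M0 h; apply/ler_addgt0Pr => e e0.
have half_cvg : (fun S => M * 2^-1 ^+ S) @ \oo --> (M * 0 : R).
  apply: cvgM; first exact: cvg_cst.
  by apply: cvg_expr; rewrite ger0_norm ?invr_ge0//; lra.
rewrite mulr0 in half_cvg; have /cvgrPdist_lt/(_ _ e0)[S0 _ hS] := half_cvg.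
have := hS (maxn S0 r) (leq_maxl _ _); rewrite /= sub0r normrN => h1.
have := h (maxn S0 r) (leq_maxr _ _); have := ler_norm (M * 2^-1 ^+ maxn S0 r).
lra.
Qed.

Lemma probability_summable (mu : probability nat R) :
  abs_summable (fun k => fine (mu [set k])).
Proof. exact: (charge_abs_summable (charge_of_finite_measure mu)). Qed.

(** A signed measure has real point masses, so the scheme exists only if the b_s
    are real. They are: conjugating the expansion at - xi gives a second expansion
    of G xi, and the two agree by the principle of isolated zeros. *)
Lemma circle_coefs_real (tau : R) (b : nat -> R[i]) (G : R -> R[i]) : 0 < tau ->
  (forall xi : R, ccvg (fun N => 1 + \sum_(2 <= s < N) b s * (expi xi - 1) ^+ s)
     (G xi)) ->
  (forall xi, G (- xi) = conjc (G xi)) ->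
  (forall s, (2 <= s)%N -> cmod (b s) <= (tau / Num.sqrt s%:R) ^+ s) ->
  exists beta : nat -> R, [/\ beta 0%N = 1, beta 1%N = 0,
    forall s, (2 <= s)%N -> b s = (beta s)%:C,
    forall s, `|beta s| <= (tau / Num.sqrt s%:R) ^+ s &
    forall xi, ccvg (fun N => \sum_(s < N) (beta s)%:C * (expi xi - 1) ^+ s)
     (G xi)].
Proof.
move=> tau0 bG G_conj b_le.
pose c s : R[i] := match s with 0 => 1 | 1 => 0 | _ => b s end.
have cG xi : ccvg (fun N => \sum_(s < N) c s * (expi xi - 1) ^+ s) (G xi).
  apply/(ccvg_shift _ _ 2).
  have /(ccvg_shift (fun N => 1 + \sum_(2 <= s < N) b s * (expi xi - 1) ^+ s)
    (G xi) 2) := bG xi.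
  congr ccvg; apply/funext => N.
  rewrite -(big_mkord xpredT (fun s => c s * (expi xi - 1) ^+ s)).
  rewrite [RHS](@big_cat_nat _ _ _ 2) ?addn2//=; congr (_ + _).
    by rewrite big_nat_recr//= big_nat1 mul0r addr0 mulr1.
  by apply: eq_big_nat => -[|[|s]].
have c_le s : cmod (c s) <= (tau / Num.sqrt s%:R) ^+ s.
  case: s => [|[|s]]; [by rewrite cmod1 | | exact: b_le].
  by rewrite cmod0 exprn_ge0// divr_ge0 ?ltW.
have c_conj_G xi : ccvg (fun N => \sum_(s < N) conjc (c s) * (expi xi - 1) ^+ s) (G xi).
  have := ccvg_conj (cG (- xi)); rewrite G_conj conjcK; congr ccvg.
  apply/funext => N; rewrite conj_sum; apply: eq_bigr => s _.
  by rewrite conjM conjX conjB conjc1 expiN conjcK.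
have c_conj s : c s - conjc (c s) = 0.
  pose M : R := expR ((2 * 1 * tau) ^+ 2).
  apply: (@power_series_circle_eq0 _ (fun s => c s - conjc (c s)) (2 * M)).
    have cM j : cmod (c j) <= M.
      apply: le_trans (c_le j) _.
      have := decay_le_geometric j (ltW tau0) ler01; rewrite expr1n mulr1.
      move/le_trans; apply; rewrite ler_piMr ?expR_ge0//.
      by rewrite exprn_ile1 ?invr_ge0//; lra.
    move=> j; apply: le_trans (cmodB _ _) _; rewrite cmodJ.
    by have := cM j; lra.
  move=> xi; have := ccvgB (cG xi) (c_conj_G xi); rewrite subrr.
  congr ccvg; apply/funext => N; rewrite -sumrB; apply: eq_bigr => j _.
  by rewrite mulrBl.
have cE s : c s = (complex.Re (c s))%:C.
  have /subr0_eq := c_conj s; case: (c s) => x y [] /eqP.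
  by rewrite -subr_eq0 opprK -mulr2n mulrn_eq0 /= => /eqP ->.
exists (fun s => complex.Re (c s)); split=> //.
- by move=> [|[|s]]// _; exact: (cE s.+2).
- by move=> s; rewrite -cmod_real -cE.
- by move=> xi; have := cG xi; congr ccvg; apply/funext => N;
    apply: eq_bigr => s _; rewrite -cE.
Qed.

Lemma cexp_conj (z : R[i]) : cexp (conjc z) = conjc (cexp z).
Proof.
case: z => x y; rewrite /cexp /= cosN sinN; apply/eqP.
by rewrite eq_complex /= !mul0r !subr0 !addr0 mulrN !eqxx.
Qed.

Lemma integrable_bounded (d : measure_display) (T : measurableType d)
    (P : probability T R) (X : {RV P >-> nat}) (f : nat -> R) :
  (forall k, `|f k| <= 1) -> P.-integrable setT (fun t => (f (X t))%:E).
Proof.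
move=> f1; apply: (le_integrable measurableT _ _
  (finite_measure_integrable_cst P 1 measurableT)).
  have mX : measurable_fun setT X by [].
  by apply/measurable_realfun.measurable_EFinP; exact: (measurableT_comp (f := f) _ mX).
by move=> t _ /=; rewrite normr1 lee_fin.
Qed.

(** For fixed N the first N point masses of the law are limits of those of the
    schemes of order S. With x = tau / sqrt lambda, the latter are within
    2 (4 x)^(r+1) of the scheme of order r in l1 norm, for all S and N. *)
Lemma dTV_poisson_scheme_le (d : measure_display) (T : measurableType d)
    (P : probability T R) (X : {RV P >-> nat}) (lambda tau : R) (r : nat)
    (b : nat -> R[i]) :
  0 < lambda -> 0 < tau -> (1 <= r)%N ->
  (forall xi : R,
    ccvg (fun N => 1 + \sum_(2 <= s < N) b s * (expi xi - 1) ^+ s)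
      (cexpectation P (fun t => expi (xi * (X t)%:R))
         * cexp (- lambda%:C * (expi xi - 1)))) ->
  (forall s : nat, (2 <= s)%N -> cmod (b s) <= (tau / Num.sqrt s%:R) ^+ s) ->
  4 * tau / Num.sqrt lambda < 1 ->
  (dTV (distribution P X) (poisson_scheme lambda b r)
    <= ((4 * tau / Num.sqrt lambda) ^+ r.+1)%:E)%E.
Proof.
move=> l0 tau0 r1 bG b_le x1.
pose p k := fine (distribution P X [set k]).
have pE k : distribution P X [set k] = (p k)%:E by rewrite fineK// fin_num_measure.
have p_sum : abs_summable p by exact: (probability_summable (distribution P X)).
pose F xi := cexpectation P (fun t => expi (xi * (X t)%:R)).
have pF xi : ccvg (fun N => \sum_(k < N) (p k)%:C * expi xi ^+ k) (F xi).
  have [|_ h] := @cexpectation_series _ _ _ _ X (fun k => expi (xi * k%:R)) p pE.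
    split.
      apply: (integrable_bounded X (f := fun k => complex.Re (expi (xi * k%:R)))).
      by move=> k; apply: le_trans (Re_le_cmod _) _; rewrite cmod_expi.
    apply: (integrable_bounded X (f := fun k => complex.Im (expi (xi * k%:R)))).
    by move=> k; apply: le_trans (Im_le_cmod _) _; rewrite cmod_expi.
  move: h; congr ccvg; apply/funext => N; apply: eq_bigr => k _.
  by rewrite [xi * _]mulrC expi_nat.
have F_conj xi : F (- xi) = conjc (F xi).
  refine (ccvg_unique (pF (- xi)) _); have := ccvg_conj (pF xi).
  congr ccvg; apply/funext => N; rewrite conj_sum; apply: eq_bigr => k _.
  by rewrite conjM conjX conjc_real expiN.
have G_conj xi : F (- xi) * cexp (- lambda%:C * (expi (- xi) - 1)) =
    conjc (F xi * cexp (- lambda%:C * (expi xi - 1))).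
  by rewrite conjM F_conj -cexp_conj conjM conjN conjc_real conjB conjc1 expiN.
have [beta [beta0 beta1 bE beta_le betaF]] := circle_coefs_real tau0 bG G_conj b_le.
have [M M0 hM] := scheme_approx (ltW l0) (ltW tau0) p_sum pF betaF beta_le.
apply: (dTV_le pE (poisson_scheme_set1 lambda beta0 beta1 bE r1)) => N.
apply: (@sum_pow_half_le _ _ (N%:R * M) r.+1); first by rewrite mulr_ge0.
move=> S rS; have tail := scheme_tail N l0 (ltW tau0) x1 (ltn0Sn r)
  (fun s _ => beta_le s) rS.
apply: le_trans (lerD _ tail).
  2: { rewrite -[N in N%:R]card_ord -mulrA mulr_natl -sumr_const.
  apply: ler_sum => k _; exact: hM S k. }
rewrite -big_split /=; apply: ler_sum => k _.
by rewrite -{1}(subrK (scheme lambda beta S k) (p k)) -addrA ler_normD.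
Qed.

End PartOneConclusion.

(** * The canonical product and its coefficients *)

Section CanonicalProduct.
Variable R : realType.
Implicit Types (a : nat -> R) (z w : R[i]) (rho : R).

Definition factor (x : R) z : R[i] := (1 + x%:C * z) * cexp (- x%:C * z).

Definition factor_coef (x : R) := conv (lin 1 x) (expo (- x)).

Lemma gf_factor rho x : 0 <= rho -> gf rho (factor_coef x) (factor x).
Proof.
move=> r0; apply: eq_gf (gf_conv (gf_lin 1 x r0) (gf_expo (- x) r0)) => w _.
by rewrite rmorph1 rmorphN.
Qed.

Lemma factor_coef0 x : factor_coef x 0 = 1.
Proof. by rewrite /factor_coef conv_lin0 /expo fact0 expr0 invr1 !mulr1. Qed.

Lemma factor_coef1 x : factor_coef x 1 = 0.
Proof.
rewrite /factor_coef conv_linS /expo !fact0 -[1`!]/(1%N) expr0 expr1 invr1.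
by rewrite !mul1r mulr1 addNr.
Qed.

(** The coefficient of z vanishes, so what remains beyond the constant term 1 has
    size x^2; this is what the convergence factors e^(-x z) are for. *)
Lemma factor_coef_le (x A : R) k : 1 <= A -> `|x| <= A -> (1 <= k)%N ->
  `|factor_coef x k| <= 2 * x ^+ 2 * A ^+ k.
Proof.
move=> A1 xA; have A0 : 0 <= A by lra.
case: k => [|[|k]]// _.
  rewrite factor_coef1 normr0; apply: mulr_ge0; last exact: exprn_ge0.
  by apply: mulr_ge0 => //; exact: sqr_ge0.
have expo_le n : `|expo (- x) n| <= `|x| ^+ n.
  rewrite normrM normrX normrN ler_piMl ?exprn_ge0//.
  rewrite normfV normr_nat invf_le1 ?ltr0n ?fact_gt0//.
  by rewrite ler1n fact_gt0.
rewrite /factor_coef conv_linS mul1r; apply: le_trans (ler_normD _ _) _.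
rewrite [`|x * _|]normrM -mulrA mulr_natl mulr2n.
have h : `|x| ^+ k.+2 <= x ^+ 2 * A ^+ k.+2.
  rewrite -(real_normK (num_real x)) -[k.+2]addn2 exprD mulrC exprD.
  apply: ler_wpM2l; first exact: sqr_ge0.
  apply: le_trans (_ : A ^+ k <= _); first by rewrite lerXn2r ?nnegrE//; lra.
  by rewrite ler_peMr ?exprn_ge0 ?exprn_ege1//; lra.
apply: lerD; first exact: le_trans (expo_le k.+2) h.
by apply: le_trans h; rewrite [leRHS]exprS; apply: ler_wpM2l.
Qed.

(** |1 + w|^2 = 1 + 2 Re w + |w|^2 <= exp (2 Re w + |w|^2). *)
Lemma cmod_factor_le (x : R) z :
  cmod (factor x z) <= expR (x ^+ 2 * cmod z ^+ 2 / 2).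
Proof.
rewrite /factor mulNr; set w := x%:C * z.
have wz : cmod w ^+ 2 = x ^+ 2 * cmod z ^+ 2.
  by rewrite /w cmodM cmod_real exprMn real_normK ?num_real.
rewrite -wz cmodM cmod_cexp.
have ReN : complex.Re (- w) = - complex.Re w by case: (w).
have sq (v : R[i]) : cmod v ^+ 2 = complex.Re v ^+ 2 + complex.Im v ^+ 2.
  by rewrite cmodE sqr_sqrtr// addr_ge0 ?sqr_ge0.
have h : cmod (1 + w) <= expR (complex.Re w + cmod w ^+ 2 / 2).
  rewrite -(@ler_pXn2r _ 2) ?nnegrE ?cmod_ge0 ?expR_ge0//.
  rewrite -expRM_natl; apply: le_trans (expR_ge1Dx _).
  rewrite !sq; move: (w) => [u v] /=; rewrite add0r; nra.
apply: le_trans (ler_wpM2r (expR_ge0 _) h) _.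
by rewrite ReN -expRD addrAC subrr add0r.
Qed.

Fixpoint prod_coef a N : nat -> R :=
  if N is n.+1 then conv (prod_coef a n) (factor_coef (a n)) else lin 1 0.

Lemma gf_prod rho a N : 0 <= rho ->
  gf rho (prod_coef a N) (fun z => \prod_(i < N) factor (a i) z).
Proof.
move=> r0; elim: N => [|N IH] /=.
  by apply: eq_gf (gf_lin 1 0 r0) => w _; rewrite big_ord0 rmorph0 mul0r addr0 rmorph1.
by apply: eq_gf (gf_conv IH (gf_factor (a N) r0)) => w _; rewrite big_ord_recr.
Qed.

Lemma prod_coef0 a N : prod_coef a N 0 = 1.
Proof.
elim: N => //= N IH.
by rewrite /conv big_ord_recl big_ord0 addr0 IH factor_coef0 mulr1.
Qed.

Lemma prod_coef1 a N : prod_coef a N 1 = 0.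
Proof.
elim: N => //= N IH; rewrite /conv !big_ord_recl big_ord0 addr0 /=.
by rewrite subn0 factor_coef1 mulr0 add0r IH mul0r.
Qed.

Section SquareSummable.
Variable a : nat -> R.
Hypothesis a2 : square_summable a.

Let S := limn (series (fun i => a i ^+ 2)).

Lemma sum_sqr_le N : \sum_(i < N) a i ^+ 2 <= S.
Proof.
have := nondecreasing_cvgn_le _ a2 N; rewrite /series /= big_mkord; apply.
by apply/nondecreasing_seqP => n; rewrite /series /= big_nat_recr //= lerDl sqr_ge0.
Qed.

Lemma cmod_prod_le N z :
  cmod (\prod_(i < N) factor (a i) z) <= expR (S * cmod z ^+ 2 / 2).
Proof.
apply: le_trans (_ : expR ((\sum_(i < N) a i ^+ 2) * cmod z ^+ 2 / 2) <= _).
  elim: N => [|N IH]; first by rewrite !big_ord0 cmod1 !mul0r expR0.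
  rewrite !big_ord_recr /= cmodM !mulrDl expRD.
  by apply: ler_pM; rewrite ?cmod_ge0// cmod_factor_le.
by rewrite ler_expR !ler_wpM2r ?sqr_ge0 ?invr_ge0// sum_sqr_le.
Qed.

Lemma prod_coef_le rho N s : 0 <= rho ->
  `|prod_coef a N s| * rho ^+ s <= expR (S * rho ^+ 2 / 2).
Proof.
move=> r0; apply: gf_cauchy (gf_prod a N r0) _ _ => // w wr.
apply: le_trans (cmod_prod_le N w) _.
have S0 : 0 <= S by have := sum_sqr_le 0; rewrite big_ord0.
rewrite ler_expR ler_wpM2r ?invr_ge0// ler_wpM2l//.
by rewrite lerXn2r ?nnegrE ?cmod_ge0.
Qed.

(** The increment from N to N + 1 is at most a constant times (a N)^2. *)
Lemma prod_coef_cvg s : cvgn (fun N => prod_coef a N s).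
Proof.
pose A := 1 + S; pose E := expR (S * 1 ^+ 2 / 2).
have S0 : 0 <= S by have := sum_sqr_le 0; rewrite big_ord0.
have aA N : `|a N| <= A.
  have : a N ^+ 2 <= S.
    apply: le_trans (sum_sqr_le N.+1); rewrite big_ord_recr /= lerDr.
    by apply: sumr_ge0 => i _; exact: sqr_ge0.
  by rewrite -(real_normK (num_real (a N))) /A; have := normr_ge0 (a N); nra.
have A1 : 1 <= A by rewrite /A; lra.
have step N : `|prod_coef a N.+1 s - prod_coef a N s| <=
    (s%:R * (E * (2 * A ^+ s))) * a N ^+ 2.
  rewrite /= /conv big_ord_recr /= subnn factor_coef0 mulr1 addrK.
  apply: le_trans (ler_norm_sum _ _ _) _.
  have const (x : R) : s%:R * x = \sum_(k < s) x.
    by rewrite sumr_const card_ord mulr_natl.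
  rewrite -mulrA const; apply: ler_sum => k _.
  rewrite normrM -mulrA; apply: ler_pM => //.
    by have := prod_coef_le N k ler01; rewrite expr1n mulr1.
  apply: le_trans (factor_coef_le A1 (aA N) _) _; first by rewrite subn_gt0.
  rewrite mulrAC; apply: ler_wpM2r; first exact: sqr_ge0.
  by apply: ler_wpM2l => //; apply: ler_weXn2l => //; exact: leq_subr.
pose u N := prod_coef a N s.
suff h : cvgn (series (telescope u)).
  have : cvgn (fun N => u 0%N + series (telescope u) N).
    by apply: is_cvgD; first exact: is_cvg_cst.
  by under eq_fun do rewrite -eq_sum_telescope.
apply: normed_cvg; apply: nondecreasing_is_cvgn.
  by apply/nondecreasing_seqP => n; rewrite /= /series /= big_nat_recr //= lerDl.
exists ((s%:R * (E * (2 * A ^+ s))) * S) => _ [N _ <-]; rewrite /= /series /= big_mkord.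
apply: le_trans (ler_wpM2l _ (sum_sqr_le N)); last first.
  by rewrite !mulr_ge0 ?expR_ge0 ?exprn_ge0//; lra.
by rewrite mulr_sumr; apply: ler_sum => k _; exact: step.
Qed.

Let e s := limn (fun N => prod_coef a N s).

(** The coefficients of the partial products satisfy a geometric bound uniform in
    N, by Cauchy's estimate on the circle of radius 2 |z|; hence the limit in N and
    the summation of the power series can be exchanged. *)
Lemma lim_coef_cvg z :
  exists2 l : R[i], ccvg (fun N => \prod_(i < N) factor (a i) z) l &
    ccvg (fun N => \sum_(s < N) (e s)%:C * z ^+ s) l.
Proof.
have z0 := cmod_ge0 z; pose rho := 2 * cmod z.
have r0 : 0 <= rho by rewrite mulr_ge0.
pose M := expR (S * rho ^+ 2 / 2); have M0 : 0 <= M by exact: expR_ge0.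
have termle (x : R) s : `|x| * rho ^+ s <= M ->
    cmod (x%:C * z ^+ s) <= M * 2^-1 ^+ s.
  move=> h; rewrite cmodM cmod_real cmodX.
  have -> : cmod z ^+ s = rho ^+ s * 2^-1 ^+ s.
    by rewrite -exprMn; congr (_ ^+ s); rewrite /rho; field.
  by rewrite mulrA ler_wpM2r// exprn_ge0.
have prodle N s := termle _ _ (prod_coef_le N s r0).
have half : 2^-1 < 1 :> R by lra.
have half0 : 0 <= 2^-1 :> R by rewrite invr_ge0.
have geo : abs_summable (fun s => M * 2^-1 ^+ s).
  exists (M / (1 - 2^-1)) => N; apply: le_trans (sum_geometric_le N M0 half0 half).
  by apply: ler_sum => k _; rewrite ger0_norm// mulr_ge0// exprn_ge0.
have coefcvg s : ccvg (fun N => (prod_coef a N s)%:C * z ^+ s) ((e s)%:C * z ^+ s).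
  apply: ccvgM; last exact: ccvg_cst.
  by apply: ccvg_ReIm => /=; [exact: prod_coef_cvg | exact: cvg_cst].
have ele s : cmod ((e s)%:C * z ^+ s) <= M * 2^-1 ^+ s.
  exact: (ccvg_cmod_le (coefcvg s) (fun N => prodle N s)).
have [l hl] : exists l, ccvg (fun N => \sum_(s < N) (e s)%:C * z ^+ s) l.
  apply: (@ccvg_abs_summable _ (fun s => (e s)%:C * z ^+ s)).
  have [B hB] := geo; exists B => N; apply: le_trans (hB N).
  apply: ler_sum => s _; rewrite !ger0_norm ?cmod_ge0//.
  by rewrite mulr_ge0// exprn_ge0.
exists l => //.
have h1 := tannery coefcvg prodle geo hl.
have h2 : ccvg (fun N => \prod_(i < N) factor (a i) z -
    \sum_(s < N) (prod_coef a N s)%:C * z ^+ s) 0.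
  apply: (@ccvg_squeeze _ _ _ (fun N => 2 * M * 2^-1 ^+ N)).
    rewrite -[X in _ --> X](mulr0 (2 * M)); apply: cvgM; first exact: cvg_cst.
    by apply: cvg_expr; rewrite ger0_norm.
  move=> N; rewrite subr0.
  have [_ /(_ z)] := gf_prod a N z0; rewrite lexx => /(_ isT) hN.
  exact: (ccvg_geometric_tail (u := fun s => (prod_coef a N s)%:C * z ^+ s)
    M0 half0 (lexx _) (prodle N) hN).
have := ccvgD h2 h1; rewrite add0r; congr ccvg; apply/funext => N.
by rewrite subrK.
Qed.

Lemma frakE_cvg z : ccvg (fun N => \prod_(i < N) factor (a i) z) (frakE a z).
Proof. by have [l h _] := lim_coef_cvg z; rewrite /frakE (ccvg_lim h). Qed.

Lemma cmod_frakE_le z : cmod (frakE a z) <= expR (S * cmod z ^+ 2 / 2).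
Proof. exact: (ccvg_cmod_le (@frakE_cvg z) (fun N => cmod_prod_le N z)). Qed.

Lemma frake_spec : [/\ frake a 0%N = 1, frake a 1%N = 0 &
  forall z, ccvg (fun N => \sum_(s < N) (frake a s)%:C * z ^+ s) (frakE a z)].
Proof.
rewrite /frake; apply: (@xgetPex _ (fun=> 0)
  [set e : nat -> R | [/\ e 0%N = 1, e 1%N = 0 & forall z : R[i],
    ccvg (fun N => \sum_(s < N) (e s)%:C * z ^+ s) (frakE a z)]]).
exists e; split.
- by rewrite /e; under eq_fun do rewrite prod_coef0; exact: lim_cst.
- by rewrite /e; under eq_fun do rewrite prod_coef1; exact: lim_cst.
- move=> z; have [l h1 h2] := lim_coef_cvg z.
  by rewrite (ccvg_unique (@frakE_cvg z) h1).
Qed.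

(** Convergence at 2 rho bounds the terms of the series there, so that at rho they
    are dominated by a geometric series. *)
Lemma gf_frake rho : 0 <= rho -> gf rho (frake a) (frakE a).
Proof.
move=> r0; have [_ _ fE] := frake_spec; split; last by move=> w _; exact: fE.
have /cvgP/cvg_seq_bounded bd := ccvg_cmod (fE (2 * rho)%:C).
have [B0 [_ /(_ (B0 + 1))]] := bd; rewrite ltrDl ltr01 => /(_ isT) hB.
pose B := B0 + 1; rewrite -/B in hB.
have {}hB N : cmod (\sum_(s < N) (frake a s)%:C * (2 * rho)%:C ^+ s) <= B.
  by have := hB N I; rewrite /= ger0_norm ?cmod_ge0.
have B_ge0 : 0 <= B by apply: le_trans (hB 0%N); exact: cmod_ge0.
have coef_le s : `|frake a s * rho ^+ s| <= (2 * B) * 2^-1 ^+ s.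
  pose T n := \sum_(j < n) (frake a j)%:C * (2 * rho)%:C ^+ j.
  have h : `|frake a s| * (2 * rho) ^+ s <= 2 * B.
    have -> : `|frake a s| * (2 * rho) ^+ s = cmod (T s.+1 - T s).
      rewrite /T big_ord_recr /= [_ + _ * _]addrC addrK cmodM cmodX !cmod_real.
      by rewrite [`|2 * rho|]ger0_norm// mulr_ge0.
    by apply: le_trans (cmodB _ _) _; have := hB s; have := hB s.+1; rewrite /T; lra.
  rewrite normrM (ger0_norm (exprn_ge0 s r0)).
  have -> : rho ^+ s = (2 * rho) ^+ s * 2^-1 ^+ s.
    by rewrite -exprMn; congr (_ ^+ s); field.
  by rewrite mulrA ler_wpM2r// exprn_ge0// invr_ge0.
have half : 2^-1 < 1 :> R by lra.
have half0 : 0 <= 2^-1 :> R by rewrite invr_ge0.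
have B2 : 0 <= 2 * B by rewrite mulr_ge0.
exists (2 * B / (1 - 2^-1)) => N.
by apply: le_trans (sum_geometric_le N B2 half0 half); apply: ler_sum.
Qed.

Lemma frake_cauchy rho s : 0 <= rho ->
  `|frake a s| * rho ^+ s <= expR (S * rho ^+ 2 / 2).
Proof.
move=> r0; apply: (gf_cauchy r0 (gf_frake r0)) => w wr.
apply: le_trans (cmod_frakE_le w) _.
have S0 : 0 <= S by have := sum_sqr_le 0; rewrite big_ord0.
rewrite ler_expR ler_wpM2r ?invr_ge0// ler_wpM2l//.
by rewrite lerXn2r ?nnegrE ?cmod_ge0.
Qed.

(** Cauchy's estimate at the radius sqrt s / sigma, which minimizes
    exp (sigma^2 rho^2 / 2) / rho^s. For sigma = 0 every radius is allowed, and a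
    large one shows that the coefficient vanishes. *)
Lemma frake_le s :
  `|frake a s| <= (Num.sqrt (expR 1) * l2norm a / Num.sqrt s%:R) ^+ s.
Proof.
case: s => [|s]; first by have [-> _ _] := frake_spec; rewrite normr1 expr0.
have S0 : 0 <= S by have := sum_sqr_le 0; rewrite big_ord0.
set sg := l2norm a; have SE : S = sg ^+ 2 by rewrite sqr_sqrtr.
have sg0 : 0 <= sg by exact: sqrtr_ge0.
move: sg0; rewrite le_eqVlt => /orP[/eqP sgE|sg_gt0].
  rewrite -sgE mulr0 mul0r expr0n /=.
  set v := `|_|; apply/negP => /negP; rewrite -ltNge => v0.
  have c0 : 1 <= 1 + 2 / v by rewrite lerDl divr_ge0// ltW.
  have := @frake_cauchy (1 + 2 / v) s.+1 (le_trans ler01 c0).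
  rewrite SE -sgE expr0n !mul0r expR0 -/v => h.
  have : v * (1 + 2 / v) <= 1.
    apply: le_trans h; rewrite ler_pM2l// exprS ler_peMr ?exprn_ege1//.
    exact: le_trans ler01 c0.
  by rewrite mulrDr mulr1 mulrCA divff ?gt_eqF//; lra.
(* q is sqrt e: at this radius the exponent is half the index of the coefficient *)
set q := Num.sqrt _.
have q0 : 0 < Num.sqrt s.+1%:R :> R by rewrite sqrtr_gt0.
set q' := Num.sqrt (s.+1%:R) in q0 *.
have rho0 : 0 < q' / sg by rewrite divr_gt0.
have := @frake_cauchy (q' / sg) s.+1 (ltW rho0).
have -> : S * (q' / sg) ^+ 2 / 2 = s.+1%:R * 2^-1.
  rewrite SE -[in RHS](@sqr_sqrtr _ s.+1%:R)// -/q'; field.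
  by rewrite gt_eqF.
rewrite expRM_natl.
have -> : expR (2^-1 : R) = q.
  rewrite /q (_ : expR 1 = expR (2^-1) ^+ 2) ?sqrtr_sqr ?ger0_norm ?expR_ge0//.
  by rewrite -expRM_natl divff.
rewrite -ler_pdivlMr ?exprn_gt0// -expr_div_n.
by rewrite invf_div mulrA.
Qed.

End SquareSummable.
End CanonicalProduct.

(** * Total variation distance to the derived scheme *)

Section PartTwo.
Variable R : realType.

(** Two errors add up. Replacing the scheme of order r by one of large order S costs
    [scheme_tail]. The law and the scheme of order S differ by the Poisson law
    convolved with the coefficients h of a function which is at most eps + o(1)
    on the disc |w| <= rho'; Cauchy's estimate there makes the l1 norm of h at most
    (eps + o(1)) rho' / (rho' - 1), and convolution with a probability does not
    increase it. For rho' = (1 + rho) / 2 one has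
    rho' / (rho' - 1) = (1 + rho) / (rho - 1) <= 2 rho / (rho - 1), and the factor 2
    is absorbed by the 1/2 in the total variation distance. *)
Lemma dTV_derived_scheme_le (d : measure_display) (T : measurableType d)
    (P : probability T R) (X : {RV P >-> nat}) (lambda rho eps : R)
    (a : nat -> R) (r : nat) :
  0 < lambda -> square_summable a -> 1 < rho -> (1 <= r)%N ->
  (forall w : R[i], cmod w < rho -> cintegrable P (fun t => w ^+ X t) /\
    cmod (cexpectation P (fun t => w ^+ X t) * cexp (- lambda%:C * (w - 1))
          - frakE a (w - 1)) <= eps) ->
  4 * (Num.sqrt (expR 1) * l2norm a) / Num.sqrt lambda < 1 ->
  (dTV (distribution P X) (derived_scheme lambda a r)
   <= ((4 * (Num.sqrt (expR 1) * l2norm a) / Num.sqrt lambda) ^+ r.+1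
       + eps * (rho / (rho - 1)))%:E)%E.
Proof.
move=> l0 a2 rho1 r1 hX x1; set tau := Num.sqrt (expR 1) * l2norm a in x1 *.
have tau0 : 0 <= tau by rewrite mulr_ge0 ?sqrtr_ge0.
have l0' := ltW l0.
pose beta := frake a; have [beta0 beta1 betaE] := frake_spec a2.
have beta_le s : `|beta s| <= (tau / Num.sqrt s%:R) ^+ s by exact: frake_le.
pose p k := fine (distribution P X [set k]).
have pE k : distribution P X [set k] = (p k)%:E by rewrite fineK// fin_num_measure.
pose F w := cexpectation P (fun t => w ^+ X t).
have eps0 : 0 <= eps.
  have [|_] := hX 0; first by rewrite cmod0; lra.
  by apply: le_trans; exact: cmod_ge0.
pose rho' := (1 + rho) / 2.
have rho'1 : 1 < rho' by rewrite /rho'; lra.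
have rho'rho : rho' < rho by rewrite /rho'; lra.
have rho'0 : 0 <= rho' by lra.
have gp : gf rho' p F.
  split=> [|w wr]; last first.
    have [iw _] := hX w (le_lt_trans wr rho'rho).
    by have [_] := cexpectation_series (g := fun k => w ^+ k) pE iw.
  have [|ir _] := hX rho'%:C; first by rewrite cmod_real ger0_norm.
  have [+ _] := cexpectation_series (g := fun k => rho'%:C ^+ k) pE ir.
  by move=> [B hB]; exists B => N; have := hB N; under eq_bigr do rewrite -rmorphXn.
pose M : R := expR ((2 * (rho' + 1) * tau) ^+ 2).
have M0 : 0 <= M by exact: expR_ge0.
have half0 : 0 <= 2^-1 :> R by rewrite invr_ge0.
have tail S w : cmod w <= rho' ->
    cmod (frakE a (w - 1) - \sum_(s < S) (beta s)%:C * (w - 1) ^+ s)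
      <= 2 * M * 2^-1 ^+ S.
  move=> wr; have z_le : cmod (w - 1) <= rho' + 1.
    by apply: le_trans (cmodB _ _) _; rewrite cmod1 lerD2r.
  apply: (ccvg_geometric_tail (u := fun s => (beta s)%:C * (w - 1) ^+ s)
    M0 half0 (lexx _) _ (betaE (w - 1))) => s.
  rewrite cmodM cmod_real cmodX.
  apply: le_trans (decay_le_geometric s tau0 (le_trans rho'0 _)); last by lra.
  apply: ler_pM; rewrite ?exprn_ge0 ?cmod_ge0//.
  by rewrite lerXn2r ?nnegrE ?cmod_ge0// addr_ge0.
pose K := (1 - rho'^-1)^-1.
have inv_rho' : rho'^-1 < 1 by rewrite invf_lt1//; lra.
have inv_rho'0 : 0 <= rho'^-1 by rewrite invr_ge0.
have head S N : \sum_(k < N) `|p k - scheme lambda beta S k| <=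
    (eps + 2 * M * 2^-1 ^+ S) * K.
  pose dS k := p k - scheme lambda beta S k.
  (* [pois (- lambda)] is not a probability: it is the inverse of [pois lambda]
     for the convolution *)
  pose h := conv (pois (- lambda)) dS.
  have gdS := gfB gp (gf_scheme lambda beta S rho'0).
  have gh := gf_conv (gf_pois (- lambda) rho'0) gdS.
  have hE : dS = conv (pois lambda) h.
    apply: gf_inj (gfW ler01 (ltW rho'1) gdS) _.
    apply: eq_gf (gf_conv (gf_pois lambda ler01) (gfW ler01 (ltW rho'1) gh)).
    by move=> w _; rewrite rmorphN mulNr mulrA cexp_mulN mul1r.
  pose eta := eps + 2 * M * 2^-1 ^+ S.
  have eta0 : 0 <= eta by rewrite addr_ge0// !mulr_ge0// exprn_ge0.
  have h_le k : `|h k| <= eta * rho'^-1 ^+ k.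
    have rk0 : 0 < rho' ^+ k by rewrite exprn_gt0//; lra.
    rewrite exprVn ler_pdivlMr//; apply: (gf_cauchy rho'0 gh) => w wr.
    have -> : cexp ((- lambda)%:C * (w - 1)) * (F w - cexp (lambda%:C * (w - 1)) *
        \sum_(s < S) (beta s)%:C * (w - 1) ^+ s) =
      (F w * cexp (- lambda%:C * (w - 1)) - frakE a (w - 1)) +
      (frakE a (w - 1) - \sum_(s < S) (beta s)%:C * (w - 1) ^+ s).
      rewrite addrA subrK rmorphN mulNr mulrBr mulrC; congr (_ - _).
      by rewrite mulrA [cexp (- _) * _]mulrC cexp_mulN mul1r.
    apply: le_trans (cmodD _ _) _; apply: lerD; last exact: tail.
    by have [_] := hX w (le_lt_trans wr rho'rho).
  have h_sum n : \sum_(k < n) `|h k| <= eta * K.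
    apply: le_trans (sum_geometric_le n eta0 inv_rho'0 inv_rho').
    by apply: ler_sum => k _; exact: h_le.
  have := conv_bound (fun n => sum_pois_le1 n l0') h_sum N.
  by rewrite -hE mul1r.
apply: (dTV_le pE (poisson_scheme_set1 (beta := beta) lambda beta0 beta1 _ r1)) => // N.
have K_le : K <= 2 * (rho / (rho - 1)).
  have r0 : 0 < rho - 1 by lra.
  have -> : K = (1 + rho) / (rho - 1).
    rewrite /K /rho'; field; do ?[apply/andP; split]; apply/eqP; lra.
  by rewrite mulrA ler_pM2r ?invr_gt0//; lra.
have K0 : 0 <= K by rewrite invr_ge0; lra.
apply: le_trans (_ : eps * K + 2 * (4 * tau / Num.sqrt lambda) ^+ r.+1 <= _).
  apply: (@sum_pow_half_le _ _ _ (2 * M * K) r.+1); first by rewrite !mulr_ge0.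
  move=> S rS; have t := scheme_tail N l0 tau0 x1 (ltn0Sn r) (fun s _ => beta_le s) rS.
  have -> : 2 * M * K * 2^-1 ^+ S +
      (eps * K + 2 * (4 * tau / Num.sqrt lambda) ^+ r.+1) =
    (eps + 2 * M * 2^-1 ^+ S) * K + 2 * (4 * tau / Num.sqrt lambda) ^+ r.+1 by ring.
  apply: le_trans (lerD (head S N) t); rewrite -big_split /=.
  apply: ler_sum => k _.
  by rewrite -{1}(subrK (scheme lambda beta S k) (p k)) -addrA ler_normD.
have := ler_wpM2l eps0 K_le; lra.
Qed.

End PartTwo.

(** * Asymptotics in lambda *)

Section Asymptotics.
Variable R : realType.

Lemma sqrt_expN (x : R) m : 0 < x ->
  (Num.sqrt x)^-1 ^+ m = x `^ (- (m%:R / 2)).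
Proof.
move=> x0; rewrite powRN exprVn -powR12_sqrt ?ltW// -powR_mulrn ?powR_ge0//.
by rewrite -powRrM mulrC.
Qed.

Lemma powR_half_shift (x : R) r : 0 < x ->
  x `^ (- ((r + 3)%:R / 2)) * x = x `^ (- ((r + 1)%:R / 2)).
Proof.
move=> x0; rewrite -{2}(powRr1 (ltW x0)) -powRD; last first.
  by apply/implyP => _; rewrite gt_eqF.
by congr (_ `^ _); rewrite !natrD; field.
Qed.

Lemma dTV_ge0 (mu nu : set nat -> \bar R) : (0 <= dTV mu nu)%E.
Proof.
rewrite /dTV mule_ge0 ?lee_fin ?invr_ge0//.
by apply: nneseries_ge0 => k _ _; exact: abse_ge0.
Qed.

(** Eventually lambda n >= 1, so that B + lambda n <= (B + 1) lambda n; and the two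
    terms of the bound then have the same order. *)
Lemma big_O_dTV (x : nat -> \bar R) (lambda eps : nat -> R) (A B : R) r :
  0 <= A -> 0 <= B -> (forall n, 0 <= eps n) ->
  (forall n, (0 <= x n)%E) ->
  (forall n, A < Num.sqrt (lambda n) ->
    (x n <= ((A / Num.sqrt (lambda n)) ^+ r.+1 + eps n * (B + lambda n))%:E)%E) ->
  lambda @ \oo --> +oo ->
  eps =O_\oo (fun n => lambda n `^ (- ((r + 3)%:R / 2))) ->
  (fun n => fine (x n)) =O_\oo (fun n => lambda n `^ (- ((r + 1)%:R / 2))).
Proof.
move=> A0 B0 eps0 x0 x_le lambda_oo /eqO_exP[K K0 hK].
apply/eqO_exP; exists (A ^+ r.+1 + K * (B + 1)).
  by rewrite ltr_wpDl ?exprn_ge0// mulr_gt0//; lra.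
near=> n.
have l1 : 1 <= lambda n.
  by near: n; move/cvgryPge: lambda_oo; apply.
have l0 : 0 < lambda n by lra.
have lA : A ^+ 2 + 1 <= lambda n.
  by near: n; move/cvgryPge: lambda_oo; apply.
have sA : A < Num.sqrt (lambda n).
  by rewrite -(ltr_pXn2r (n := 2)) ?nnegrE ?sqrtr_ge0// sqr_sqrtr ?ltW//; lra.
have he : eps n <= K * lambda n `^ (- ((r + 3)%:R / 2)).
  rewrite -[X in _ <= K * X]ger0_norm ?powR_ge0// -[leLHS]ger0_norm//.
  by near: n.
have [y xE y_le] : exists2 y, x n = y%:E &
    y <= (A / Num.sqrt (lambda n)) ^+ r.+1 + eps n * (B + lambda n).
  have := x_le n sA; have := x0 n; case: (x n) => [y _ h|//|//].
  by exists y; rewrite // -lee_fin.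
have y0 : 0 <= y by have := x0 n; rewrite xE lee_fin.
rewrite xE /= ger0_norm// ger0_norm ?powR_ge0// mulrDl.
apply: le_trans y_le _; apply: lerD.
  by rewrite expr_div_n -exprVn sqrt_expN// addn1.
apply: le_trans (ler_wpM2r _ he) _; first by lra.
rewrite -powR_half_shift// -!mulrA ler_pM2l// [X in _ <= X]mulrCA.
apply: ler_wpM2l; first exact: powR_ge0.
by nra.
Unshelve. all: by end_near. Qed.

End Asymptotics.

(** * The approximation theorem *)

Lemma mod_poisson_eps_ge0 (R : realType) (d : nat -> measure_display)
    (T : forall n, measurableType (d n)) (P : forall n, probability (T n) R)
    (X : forall n, {RV (P n) >-> nat}) (lambda a : nat -> R) (rho : R)
    (eps : nat -> R) n :
  mod_poisson_bernoulli X lambda a rho eps -> 0 <= eps n.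
Proof.
move=> [_ rho1 _ /(_ n 0)]; rewrite cmod0 => -[|_]; first by lra.
by apply: le_trans; exact: cmod_ge0.
Qed.

Theorem theorem3 (R : realType) :
  exists C D : R, [/\ 0 < C, C <= 570, D = 4,
    (* (i) *)
    forall (d : measure_display) (T : measurableType d) (P : probability T R)
      (X : {RV P >-> nat}) (lambda tau : R) (r : nat) (b : nat -> R[i]),
      0 < lambda -> 0 < tau -> (1 <= r)%N ->
      (forall xi : R,
        (fun N => (1 + \sum_(2 <= s < N) b s * (expi xi - 1) ^+ s) : (R[i])^o)
          @ \oo -->
        (cexpectation P (fun t => expi (xi * (X t)%:R))
           * cexp (- lambda%:C * (expi xi - 1)) : (R[i])^o)) ->
      (forall s : nat, (2 <= s)%N ->
        cmod (b s) <= (tau / Num.sqrt s%:R) ^+ s) ->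
      D * tau / Num.sqrt lambda < 1 ->
      (dTV (distribution P X) (poisson_scheme lambda b r)
        <= (C * (D * tau / Num.sqrt lambda) ^+ r.+1)%:E)%E &
    (* (ii) *)
    forall (d : nat -> measure_display) (T : forall n, measurableType (d n))
      (P : forall n, probability (T n) R) (X : forall n, {RV (P n) >-> nat})
      (lambda a : nat -> R) (rho : R) (eps : nat -> R) (r : nat),
      (forall n, 0 < lambda n) ->
      mod_poisson_bernoulli X lambda a rho eps ->
      (1 <= r)%N ->
      let sigma := l2norm a in
      let dist n :=
        dTV (distribution (P n) (X n)) (derived_scheme (lambda n) a r) in
      (forall n : nat,
        D * Num.sqrt (expR 1) * sigma < Num.sqrt (lambda n) ->
        (dist n <=
          (C * (D * Num.sqrt (expR 1) * sigma / Num.sqrt (lambda n)) ^+ r.+1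
           + eps n * (rho / (rho - 1) + lambda n))%:E)%E) /\
      (lambda @ \oo --> +oo ->
       eps =O_\oo (fun n => lambda n `^ (- ((r + 3)%:R / 2))) ->
       (fun n => fine (dist n)) =O_\oo
         (fun n => lambda n `^ (- ((r + 1)%:R / 2))))].
Proof.
exists 1, 4; split=> //; first by lra.
  move=> d T P X lambda tau r b l0 tau0 r1 bG b_le x1.
  by rewrite mul1r; exact: dTV_poisson_scheme_le.
move=> d T P X lambda a rho eps r l0 hX r1 sigma dist.
have eps0 n : 0 <= eps n by exact: mod_poisson_eps_ge0 hX.
have [a2 rho1 _ hX_n] := hX.
have s_ge0 : 0 <= Num.sqrt (expR 1) * sigma by rewrite mulr_ge0 ?sqrtr_ge0.
have c0 : 0 <= rho / (rho - 1) by rewrite divr_ge0//; lra.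
have dist_le n : 4 * Num.sqrt (expR 1) * sigma < Num.sqrt (lambda n) ->
    (dist n <= ((4 * Num.sqrt (expR 1) * sigma / Num.sqrt (lambda n)) ^+ r.+1
      + eps n * (rho / (rho - 1) + lambda n))%:E)%E.
  move=> hn; have q0 : 0 < Num.sqrt (lambda n) by rewrite sqrtr_gt0.
  rewrite -mulrA in hn *.
  apply: le_trans (dTV_derived_scheme_le (l0 n) a2 rho1 r1 (hX_n n) _) _.
    by rewrite ltr_pdivrMr// mul1r.
  by rewrite lee_fin lerD2l ler_wpM2l// lerDl ltW.
split=> [n hn|lambda_oo eps_O]; first by rewrite mul1r; exact: dist_le.
apply: (big_O_dTV (A := 4 * Num.sqrt (expR 1) * sigma) (B := rho / (rho - 1)))
  eps_O => //; first by rewrite -mulrA mulr_ge0.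
by move=> n; exact: dTV_ge0.
Qed.
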